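(* Let $k$ be a field of characteristic zero, let $f,g\in k[x]$ be nonconstant, let $r\ge1$, and let $Z$ be a geometrically integral component of the ordered configuration cover $C^{[r]}_{f,g}$ which dominates the $X$-line. Put $m=\deg f$, $n=\deg g$, $e=\gcd(m,n)$, $M=m/e$, $N=n/e$. Then, at every geometric boundary point $P\in D_Z$, $$-\mathrm{ord}_P X=N,\qquad -\mathrm{ord}_P Y_i=M\quad(1\le i\le r).$$ Consequently $$d_X(Z)=N\,\#D_Z.$$ In particular, every geometrically integral one-infinity component $Z$ of $C^{[r]}_{f,g}$ (i.e. one with $\#D_Z=1$) dominating the $X$-line has $d_X(Z)=N$.
   Context: $C_{f,g}=(f(X)-g(Y)=0)_{\mathrm{red}}\subset\mathbb A^2_k$. A graph component is an irreducible component of the form $Y=h(X)$ with $h\in k[X]$, $f=g\circ h$. $C^{\mathrm{new}}_{f,g}$ is the reduced union of the non-graph irreducible components of $C_{f,g}$ over $k$; it is finite over the $X$-line $\mathbb A^1_X$. For $r\ge1$ form the $r$-fold fiber product $(C^{\mathrm{new}}_{f,g})^r_{\mathbb A^1_X}=C^{\mathrm{new}}_{f,g}\times_{\mathbb A^1_X}\cdots\times_{\mathbb A^1_X}C^{\mathrm{new}}_{f,g}$, with pulled-back $Y$-coordinates $Y_1,\ldots,Y_r$. The ordered $r$-configuration cover $C^{[r]}_{f,g}$ is the reduced union of those irreducible components of this fiber product on which $Y_i\neq Y_j$ for all $i\ne j$ at the generic point. For a geometrically integral affine curve $Z$: $Z^\nu$ is its affine normalization, $\widetilde Z$ its smooth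 projective normalization, and $D_Z=\widetilde Z\setminus Z^\nu$ is the set of geometric boundary points. $X,Y_i$ are viewed as rational functions on $\widetilde Z$, and $d_X(Z)=[k(Z):k(X)]$. *)

(* Defs.v *)
From HB Require Import structures.
From mathcomp Require Import all_boot all_order all_algebra.
From mathcomp Require Import generic_quotient ring_quotient fraction mpoly.
From mathcomp Require Import boolp classical_sets functions cardinality.

Set Implicit Arguments.
Unset Strict Implicit.
Unset Printing Implicit Defensive.

Import GRing.Theory.

Local Open Scope classical_set_scope.
Local Open Scope ring_scope.

(* Closed subschemes of affine space are given by their ideals; an integral
   closed subscheme (in particular an irreducible component with its reduced
   structure) is a prime ideal. *)
Section Ideals.
Variable A : comNzRingType.
Implicit Types I p q S : set A.

Definition is_ideal I : Prop :=
  [/\ I 0, forall a b, I a -> I b -> I (a + b) & forall a b, I b -> I (a * b)].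

Definition is_prime I : Prop :=
  [/\ is_ideal I, ~ I 1 & forall a b, I (a * b) -> I a \/ I b].

Definition ideal_gen S : set A := smallest is_ideal S.

(* p is a minimal prime over I, i.e. V(p) is an irreducible component of V(I);
   only the reduced structure of V(I) matters. *)
Definition is_component I p : Prop :=
  [/\ is_prime p, I `<=` p & forall q, is_prime q -> I `<=` q -> q `<=` p -> q = p].

Record prime_ideal := PrimeIdeal {
  prime_set :> set A;
  prime_setP : is_prime prime_set }.

Definition prime_pred (P : prime_ideal) : {pred A} :=
  fun a => a \in prime_set P.

Lemma prime_pred_idealr (P : prime_ideal) : idealr_closed (prime_pred P).
Proof.
case: (prime_setP P) => -[P0 PD PM] P1 _; split; first exact/mem_set.
  by apply/negP => /set_mem.
by move=> a u v /set_mem Pu /set_mem Pv; apply/mem_set/PD => //; apply: PM.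
Qed.

Lemma prime_pred_prime (P : prime_ideal) : prime_idealr_closed (prime_pred P).
Proof.
case: (prime_setP P) => _ _ PP a b /set_mem /PP[] h; apply/orP.
  by left; apply/mem_set.
by right; apply/mem_set.
Qed.

HB.instance Definition _ (P : prime_ideal) :=
  isIdealr.Build A (prime_pred P) (prime_pred_idealr P).
HB.instance Definition _ (P : prime_ideal) :=
  isPrimeIdealrClosed.Build A (prime_pred P) (@prime_pred_prime P).

(* Units are decided and inverted classically, which the interface of integral
   domains (and hence of fraction fields) asks for. *)
Definition prime_quot (P : prime_ideal) : Type := {ideal_quot (prime_pred P)}.

HB.instance Definition _ P := GRing.ComNzRing.on (prime_quot P).

Definition prime_quot_unit P : {pred prime_quot P} :=
  fun x => `[< exists y, y * x = 1 >].

Definition prime_quot_inv P (x : prime_quot P) : prime_quot P :=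
  if pselect (exists y, y * x = 1) is left h then sval (cid h) else x.

Lemma prime_quot_mulVx P :
  {in @prime_quot_unit P, left_inverse 1 (@prime_quot_inv P) *%R}.
Proof.
move=> x /asboolP h; rewrite /prime_quot_inv.
by case: pselect => // h'; case: cid.
Qed.

Lemma prime_quot_unitPl P (x y : prime_quot P) :
  y * x = 1 -> prime_quot_unit x.
Proof. by move=> h; apply/asboolP; exists y. Qed.

Lemma prime_quot_inv_out P :
  {in [predC @prime_quot_unit P], @prime_quot_inv P =1 id}.
Proof.
move=> x /negP h; rewrite /prime_quot_inv.
by case: pselect => // h'; case: h; apply/asboolP.
Qed.

HB.instance Definition _ P := GRing.ComNzRing_hasMulInverse.Build (prime_quot P)
  (@prime_quot_mulVx P) (@prime_quot_unitPl P) (@prime_quot_inv_out P).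

HB.instance Definition _ P := GRing.ComUnitRing_isIntegral.Build (prime_quot P)
  (@Quotient.rquot_IdomainAxiom A (prime_pred P)).

End Ideals.

(* V(Z) in affine n-space over k. *)
Section FunctionField.
Variables (k : fieldType) (n : nat) (Z : prime_ideal {mpoly k[n]}).

Definition coord_ring : idomainType := prime_quot Z.

Definition function_field : fieldType := {fraction coord_ring}.

Definition restr (p : {mpoly k[n]}) : function_field :=
  tofrac (\pi_({ideal_quot (prime_pred Z)})%qT p : coord_ring).

(* The subfield k(t) generated over k by t. *)
Definition gen_subfield (t : function_field) : set function_field :=
  [set z | exists a b : {poly k},
    let ev (c : {poly k}) := (map_poly (fun x : k => restr x%:MP) c).[t] in
    ev b != 0 /\ z = ev a / ev b].

(* The normalized discrete valuations of k(Z) trivial on k. When k is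
   algebraically closed and V(Z) is a curve, these are the points of the smooth
   projective model of V(Z), with v = ord_P. The value at 0 is fixed by
   convention so that one point corresponds to exactly one function. *)
Definition is_place (v : function_field -> int) : Prop :=
  [/\ v 0 = 0 /\ (exists2 t : function_field, t != 0 & v t = 1),
      forall c : k, c != 0 -> v (restr c%:MP) = 0,
      forall x y : function_field, x != 0 -> y != 0 -> v (x * y) = v x + v y
    & forall x y : function_field, x != 0 -> y != 0 -> x + y != 0 ->
        Num.min (v x) (v y) <= v (x + y)].

(* The coordinate ring of the affine normalization: the integral closure of
   k[Z] in k(Z). *)
Definition normalization : set function_field :=
  [set z | integralOver (@tofrac coord_ring) z].

(* A point of the projective model lies on the affine normalization iff its
   valuation ring contains the coordinate ring of the latter. *)
Definition boundary : set (function_field -> int) :=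
  [set v | is_place v /\ ~ (forall z, normalization z -> 0 <= v z)].

End FunctionField.

Arguments boundary {k n} Z _.

(* [F : E] = d, for a subfield E of F. *)
Definition has_degree (F : fieldType) (E : set F) (d : nat) : Prop :=
  exists b : 'I_d -> F, forall z : F, exists! c : {ffun 'I_d -> F},
    (forall i, E (c i)) /\ z = \sum_i c i * b i.

Definition is_algebraic_closure (k : fieldType) (K : closedFieldType)
  (iota : {rmorphism k -> K}) : Prop := forall z : K, algebraicOver iota z.

Section BaseChange.
Variables (k K : fieldType) (iota : {rmorphism k -> K}) (n : nat).
Variable Z : prime_ideal {mpoly k[n]}.

Definition base_change_ideal : set {mpoly K[n]} :=
  ideal_gen [set map_mpoly iota p | p in (Z : set _)].

(* To be used with K an algebraic closure of k. *)
Definition geometrically_integral : Prop := is_prime base_change_ideal.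

Definition base_change (h : geometrically_integral) : prime_ideal {mpoly K[n]} :=
  PrimeIdeal h.

End BaseChange.

(* The univariate polynomial p evaluated at the i-th variable. *)
Definition in_var (k : fieldType) (n : nat) (i : 'I_n) (p : {poly k}) :
    {mpoly k[n]} := (map_poly (@mpolyC n k) p).['X_i].

(* Coordinates X, Y_1, ..., Y_r on affine (r+1)-space. *)
Definition varX {r : nat} : 'I_r.+1 := ord0.
Definition varY {r : nat} (i : 'I_r) : 'I_r.+1 := lift ord0 i.

Section Configuration.
Variables (k : fieldType) (f g : {poly k}).

(* C_{f,g}, in the plane with coordinates X and Y = Y_1. *)
Definition curve_ideal : set {mpoly k[2]} :=
  ideal_gen [set in_var varX f - in_var (varY ord0) g].

Definition is_graph (q : set {mpoly k[2]}) : Prop :=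
  exists2 h : {poly k}, f = g \Po h &
    q = ideal_gen [set 'X_(varY ord0) - in_var varX h].

Definition new_ideal : set {mpoly k[2]} :=
  [set p | forall q, is_component curve_ideal q -> ~ is_graph q -> q p].

(* The tensor power over k[X] of k[X,Y]/I is the quotient of k[X,Y_1,...,Y_r]
   by the ideal generated by all p(X,Y_i) with p in I. *)
Definition fiber_power_ideal (r : nat) : set {mpoly k[r.+1]} :=
  ideal_gen [set p | exists (i : 'I_r) (q : {mpoly k[2]}),
    new_ideal q /\ p = q \mPo [tuple 'X_varX; 'X_(varY i)]].

Arguments fiber_power_ideal r _ : clear implicits.

Definition config_ideal (r : nat) : set {mpoly k[r.+1]} :=
  [set p | forall q, is_component (fiber_power_ideal r) q ->
    (forall i j : 'I_r, i != j -> ~ q ('X_(varY i) - 'X_(varY j))) -> q p].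

End Configuration.

Arguments fiber_power_ideal {k} f g r _.
Arguments config_ideal {k} f g r _.

Definition dominates_X (k : fieldType) (r : nat)
  (Z : prime_ideal {mpoly k[r.+1]}) : Prop :=
  forall p : {poly k}, prime_set Z (in_var varX p) -> p = 0.

(* d_X(Z) = [k(Z) : k(X)] = d. *)
Definition X_degree (k : fieldType) (r : nat)
  (Z : prime_ideal {mpoly k[r.+1]}) (d : nat) : Prop :=
  has_degree (gen_subfield (restr Z 'X_varX)) d.

(* Main.v *)
(* Over an algebraic closure K, put X = t^-N in the field K((t)). By Hensel's
   lemma the equation g(Y) = f(t^-N) has deg g roots in K((t)); they have order
   -M and are told apart by their leading coefficients. Hence K(Z), which is
   generated over K(X) by such roots, has d = [K(Z) : K(X)] embeddings in K((t))
   over K(X), and the t-adic order pulls back along each of them to a place with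
   X of order -N and Y_i of order -M, normalized because M and N are coprime.
   Every place at infinity arises so: by weak approximation another one would
   have a pole at some z regular at all the pulled-back places, but the
   characteristic polynomial of z over K(X) has the conjugates of z as roots, so
   that z is integral at infinity. Two embeddings define the same place iff they
   differ by a substitution t -> ct with c^N = 1, and these act freely, whence
   d = N * #D. Finally [k(Z) : k(X)] = [K(Z) : K(X)], as k-linear functionals
   K -> k turn relations over K(X) into relations over k(X). *)
From HB Require Import structures.
Require Import Defs.
From mathcomp Require Import all_boot all_order all_algebra all_field.
From mathcomp Require Import generic_quotient ring_quotient fraction mpoly zify ring.
From mathcomp Require Import boolp classical_sets functions cardinality.

Set Implicit Arguments.
Unset Strict Implicit.
Unset Printing Implicit Defensive.

Import Order.TTheory GRing.Theory Num.Theory.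

Local Open Scope classical_set_scope.
Local Open Scope ring_scope.

(** * Valuations on a field *)

(** The constants [c] with [g_n c^n = f_m] are [n] distinct nonzero numbers in characteristic zero,
    so a root of [g(Y) = f(t^-N)] is determined modulo [t^(1-M)], and an embedding of [K(Z)] over
    [K(X)] by the leading coefficients of the images of the [Y_i]. This finite datum makes the count
    possible. That all [d] embeddings land in [K((t))] needs no normal closure: a conjugate of the
    primitive element in any larger field embeds [K(Z)] there, but sends each [Y_i] to a root of a
    polynomial already split over [K((t))]. For the count, an element [u] of order 1 is followed.
    Under [t -> ct] its leading coefficient is multiplied by [c], which gives freeness. Conversely
    [X u^N] has order 0 and a residue that depends on the place alone, namely the [N]-th power of
    the leading coefficient of [u]; two embeddings with the same place therefore become equal on
    leading terms after one substitution with [c^N = 1]. The base change is handled without tensor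
    products: the minimal polynomial over [k(X)] is shown to stay minimal over [K(X)]. *)

Section Valuations.
Variables (F : fieldType) (v : F -> int).

Definition valuation : Prop :=
  (forall x y, x != 0 -> y != 0 -> v (x * y) = v x + v y) /\
  (forall x y, x != 0 -> y != 0 -> x + y != 0 -> Num.min (v x) (v y) <= v (x + y)).

(* [v x >= n], with [v 0] read as infinity whatever the function [v] says. *)
Definition vge (n : int) (x : F) : bool := (x == 0) || (n <= v x).

Hypothesis vP : valuation.

Lemma val_mul x y : x != 0 -> y != 0 -> v (x * y) = v x + v y.
Proof. exact: vP.1. Qed.

Lemma val_1 : v 1 = 0.
Proof.
have := @val_mul 1 1 (oner_neq0 _) (oner_neq0 _); rewrite mulr1 => h; lia.
Qed.

Lemma val_exp x n : x != 0 -> v (x ^+ n) = v x *+ n.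
Proof.
move=> x0; elim: n => [|n IH]; first by rewrite expr0 val_1.
by rewrite exprS val_mul ?expf_neq0 // IH mulrS.
Qed.

Lemma val_N x : v (- x) = v x.
Proof.
have vm1 : v (- 1) = 0.
  have m10 : (- 1 : F) != 0 by rewrite oppr_eq0 oner_neq0.
  by have := val_mul m10 m10; rewrite mulrNN mulr1 val_1 => h; lia.
have [->|x0] := eqVneq x 0; first by rewrite oppr0.
by rewrite -mulN1r val_mul ?oppr_eq0 ?oner_neq0 // vm1 add0r.
Qed.

Lemma val_inv x : x != 0 -> v x^-1 = - v x.
Proof.
move=> x0; have := val_mul x0 (invr_neq0 x0); rewrite divff // val_1 => h; lia.
Qed.

Lemma val_div x y : x != 0 -> y != 0 -> v (x / y) = v x - v y.
Proof. by move=> x0 y0; rewrite val_mul ?invr_eq0 // val_inv. Qed.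

Lemma vge0 n : vge n 0. Proof. by rewrite /vge eqxx. Qed.

Lemma vge_val x : vge (v x) x. Proof. by rewrite /vge lexx orbT. Qed.

Lemma vgeE n x : x != 0 -> vge n x = (n <= v x).
Proof. by rewrite /vge => /negPf->. Qed.

Lemma vgeW m n x : m <= n -> vge n x -> vge m x.
Proof. by rewrite /vge => mn /orP[->//|nx]; rewrite (le_trans mn nx) orbT. Qed.

Lemma vgeN n x : vge n (- x) = vge n x.
Proof. by rewrite /vge oppr_eq0 val_N. Qed.

Lemma vgeD n x y : vge n x -> vge n y -> vge n (x + y).
Proof.
have [->|x0] := eqVneq x 0; first by rewrite add0r.
have [->|y0] := eqVneq y 0; first by rewrite addr0.
have [->|xy0] := eqVneq (x + y) 0; first by rewrite vge0.
rewrite !vgeE // => nx ny; apply: le_trans (vP.2 _ _ x0 y0 xy0).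
by rewrite le_min nx ny.
Qed.

Lemma vgeB n x y : vge n x -> vge n y -> vge n (x - y).
Proof. by move=> nx ny; apply: vgeD; rewrite ?vgeN. Qed.

Lemma vge_sum n I (r : seq I) (P : pred I) (G : I -> F) :
  (forall i, P i -> vge n (G i)) -> vge n (\sum_(i <- r | P i) G i).
Proof.
move=> h; apply: (big_ind (fun x => vge n x)) => //; first exact: vge0.
by move=> x y; apply: vgeD.
Qed.

Lemma vgeM a b x y : vge a x -> vge b y -> vge (a + b) (x * y).
Proof.
have [->|x0] := eqVneq x 0; first by rewrite mul0r !vge0.
have [->|y0] := eqVneq y 0; first by rewrite mulr0 !vge0.
by rewrite !vgeE ?mulf_neq0 // val_mul // => ax byy; lia.
Qed.

Lemma vgeM0 x y : vge 0 x -> vge 0 y -> vge 0 (x * y).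
Proof. by move=> hx hy; have := vgeM hx hy; rewrite addr0. Qed.

Lemma vge1 : vge 0 1.
Proof. by rewrite vgeE ?oner_neq0 // val_1. Qed.

Lemma vgeX x n : vge 0 x -> vge 0 (x ^+ n).
Proof.
move=> hx; elim: n => [|n IH]; first exact: vge1.
by rewrite exprS; apply: vgeM0.
Qed.

Lemma val_dominant x y : x != 0 -> vge (v x + 1) y -> x + y != 0 /\ v (x + y) = v x.
Proof.
move=> x0; have [->|y0] := eqVneq y 0; first by rewrite addr0.
rewrite vgeE // => xy.
have xy0 : x + y != 0.
  apply/eqP => h; have yE : y = - x by apply/eqP; rewrite -addr_eq0 addrC h.
  by move: xy; rewrite yE val_N; lia.
split=> //; apply/eqP; rewrite eq_le; apply/andP; split; last first.
  by have := vP.2 _ _ x0 y0 xy0; rewrite min_l //; lia.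
rewrite leNgt; apply/negP => h.
(* If the sum had larger order than [x], so would [x = (x + y) - y]. *)
have : vge (v x + 1) (x + y - y).
  by apply: vgeB; rewrite vgeE //; lia.
by rewrite addrK vgeE //; lia.
Qed.

Lemma vge_horner (p : {poly F}) x :
  (forall i, vge 0 p`_i) -> vge 0 x -> vge 0 p.[x].
Proof.
move=> hp hx; rewrite horner_coef; apply: vge_sum => i _.
by apply: vgeM0 => //; apply: vgeX.
Qed.

(** At a pole the top term strictly dominates: each lower power of [x] gains at least one in order,
    and the coefficients cannot compensate. *)
Lemma val_horner_pole (p : {poly F}) x : p != 0 -> x != 0 -> v x < 0 ->
    (forall i, vge 0 p`_i) -> v (lead_coef p) = 0 ->
  p.[x] != 0 /\ v p.[x] = v x *+ (size p).-1.
Proof.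
move=> p0 x0 vx hp vl; set n := (size p).-1.
have sn : size p = n.+1 by rewrite prednK // size_poly_gt0.
have lE : p`_n = lead_coef p by [].
have lx0 : p`_n * x ^+ n != 0 by rewrite mulf_neq0 ?expf_neq0 // lE lead_coef_eq0.
have vE : v (p`_n * x ^+ n) = v x *+ n.
  by rewrite val_mul ?expf_neq0 ?lE ?lead_coef_eq0 // vl add0r val_exp.
rewrite horner_coef sn big_ord_recr /= addrC -vE; apply: val_dominant => //.
rewrite vE; apply: vge_sum => i _.
have : vge (0 + v x *+ i) (p`_i * x ^+ i).
  by apply: vgeM (hp i) _; rewrite -val_exp // vge_val.
apply: vgeW; rewrite add0r; case: i => i /= ltin.
rewrite -{1}(subnKC ltin) addSn mulrS mulrnDr.
have : v x *+ (n - i.+1) <= 0 by apply: mulrn_wle0; apply: ltW.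
lia.
Qed.

(** Valuation rings are integrally closed: by [val_horner_pole] such a polynomial takes a nonzero
    value at a pole. *)
Lemma vge_integral (p : {poly F}) x : p \is monic -> (forall i, vge 0 p`_i) ->
  root p x -> vge 0 x.
Proof.
move=> mp hp; apply: contraTT; rewrite /vge negb_or -ltNge => /andP[x0 vx].
by have [] := val_horner_pole (monic_neq0 mp) x0 vx hp; rewrite ?(monicP mp) ?val_1.
Qed.

End Valuations.

Lemma mulrn_lower (b : int) n : 0 < b -> n%:Z <= b *+ n.
Proof. by move=> b0; elim: n => [|n IH]; rewrite ?mulrS //; lia. Qed.

Lemma mulrn_upper (b : int) n : b < 0 -> b *+ n <= - n%:Z.
Proof. by move=> b0; elim: n => [|n IH]; rewrite ?mulrS //; lia. Qed.

(** * Weak approximation for finitely many discrete valuations *)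

Section WeakApproximation.
Variable F : fieldType.
Implicit Types v w : F -> int.

Definition normalized v : Prop := exists2 t : F, t != 0 & v t = 1.

(** A discrete valuation ring is maximal. Units for [w] are units for [v], so [v] is [v p] times [w]
    for a uniformizer [p] of [w]; since [v] takes the value 1 and [v p] is nonnegative,
    [v p = 1]. *)
Lemma val_le_eq v w : valuation v -> valuation w -> normalized v -> normalized w ->
    (forall x, x != 0 -> 0 <= w x -> 0 <= v x) ->
  forall x, x != 0 -> v x = w x.
Proof.
move=> vP wP [t t0 vt] [p p0 wp] wv.
have unit x : x != 0 -> w x = 0 -> v x = 0.
  move=> x0 wx; have := wv _ x0; rewrite wx => /(_ isT) v1.
  have := wv _ (invr_neq0 x0); rewrite !val_inv // wx oppr0 => /(_ isT); lia.
have vpw x : x != 0 -> v x = w x * v p.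
  move=> x0; have wxE : (w x = Posz `|w x|%N) \/ (w x = - Posz `|w x|%N) by lia.
  set n := `|w x|%N in wxE; case: wxE => wx.
    have := unit (x / p ^+ n); rewrite !val_div ?expf_neq0 // !val_exp // wp wx.
    rewrite mulf_neq0 ?invr_eq0 ?expf_neq0 // => /(_ isT).
    rewrite natz subrr => /(_ erefl)/eqP; rewrite subr_eq0 => /eqP->.
    by rewrite mulrC -mulr_natr natz.
  have := unit (x * p ^+ n); rewrite !val_mul ?expf_neq0 // !val_exp // wp wx.
  rewrite mulf_neq0 ?expf_neq0 // => /(_ isT).
  rewrite natz addNr => /(_ erefl)/eqP; rewrite addr_eq0 => /eqP->.
  by rewrite mulNr mulrC -mulr_natr natz.
have vp1 : v p = 1.
  have /(congr1 absz)/esym/eqP := vpw t t0; rewrite vt abszM muln_eq1 => /andP[_ /eqP vp].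
  have := wv p p0; rewrite wp => /(_ isT); lia.
by move=> x x0; rewrite vpw // vp1 mulr1.
Qed.

(** By [val_le_eq] neither valuation ring contains the other; the quotient of witnesses for the two
    non-inclusions has strict signs at both places. *)
Lemma val_separate v w : valuation v -> valuation w -> normalized v -> normalized w ->
    ~ (forall x, x != 0 -> v x = w x) ->
  exists z, [/\ z != 0, v z < 0 & 0 < w z].
Proof.
move=> vP wP nv nw vw.
have sep v1 w1 : valuation v1 -> valuation w1 -> normalized v1 -> normalized w1 ->
    ~ (forall x, x != 0 -> v1 x = w1 x) ->
    exists a, [/\ a != 0, v1 a < 0 & 0 <= w1 a].
  move=> vP1 wP1 nv1 nw1 vw1; apply: contrapT => h; apply: vw1.
  apply: val_le_eq => // x x0 wx; rewrite leNgt; apply/negP => vx.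
  by apply: h; exists x.
have [a [a0 va wa]] := sep v w vP wP nv nw vw.
have [|b [b0 vb wb]] := sep w v wP vP nw nv.
  by move=> h; apply: vw => x x0; rewrite h.
by exists (a / b); rewrite mulf_neq0 ?invr_eq0 // !val_div //; split=> //; lia.
Qed.

(** Induction on [s]: [z] serves the old places, [a] separates [v] from the new one. If [z] has
    positive order at the new place, [z] itself works; if order 0, then [a] times a high power of
    [z]; if it has a pole there, the power must be tamed first. *)
Lemma weak_approximation (I : eqType) v (w : I -> F -> int) (s : seq I) :
    valuation v -> normalized v ->
    (forall i, i \in s -> [/\ valuation (w i), normalized (w i)
       & ~ (forall x, x != 0 -> v x = w i x)]) ->
  exists z, [/\ z != 0, v z < 0 & forall i, i \in s -> 0 < w i z].
Proof.
move=> vP nv; elim: s => [_|i s IH hs].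
  by case: nv => t t0 vt; exists t^-1; rewrite invr_eq0 val_inv // vt.
have [|z [z0 vz wz]] := IH; first by move=> j js; apply: hs; rewrite inE js orbT.
have [wP nw vw] := hs i (mem_head _ _).
have [a [a0 va wa]] := val_separate vP wP nv nw vw.
have wjP j : j \in s -> valuation (w j).
  by move=> js; have [] := hs j; rewrite ?inE ?js ?orbT.
(* A power of [z] high enough to outweigh any pole of [a] at the old places. *)
have [r hr] : exists r : nat, forall j, j \in s -> 0 < w j a + w j z *+ r.+1.
  elim: (s) wz => [|j s' IHs] wz; first by exists 0%N => j; rewrite in_nil.
  have [|r hr] := IHs; first by move=> l ls; apply: wz; rewrite inE ls orbT.
  exists (r + `|w j a|)%N => l ls.
  have wl : 0 < w l z by apply: wz.
  move: ls; rewrite inE => /orP[/eqP ->|/hr].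
    have := mulrn_lower (r + `|w j a|).+1 (wz j (mem_head _ _)); lia.
  have := mulrn_lower `|w j a| wl; rewrite -addSn mulrnDr; lia.
have [wiz0|wiz|wiz] := ltgtP (w i z) 0; last 2 first.
- by exists z; split=> // j; rewrite inE => /orP[/eqP->|/wz].
- exists (a * z ^+ r.+1); split; first by rewrite mulf_neq0 ?expf_neq0.
    by rewrite val_mul ?expf_neq0 // val_exp //; have := mulrn_upper r.+1 vz; lia.
  move=> j; rewrite inE => /orP[/eqP->|js].
    by rewrite val_mul ?expf_neq0 // val_exp // wiz mul0rn addr0.
  have wj := wjP j js.
  by rewrite val_mul ?expf_neq0 // val_exp //; apply: hr.
(* The factor [z^(r+1) / (z^(r+1) + 1)] has order 0 at both poles [v] and [w i] of [z], and the
   order of [z^(r+1)] where [z] has positive order. *)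
have zr0 : z ^+ r.+1 != 0 by rewrite expf_neq0.
have pole w1 : valuation w1 -> w1 z < 0 ->
    z ^+ r.+1 + 1 != 0 /\ w1 (z ^+ r.+1 + 1) = w1 (z ^+ r.+1).
  move=> w1P wz1; apply: val_dominant => //; rewrite vgeE ?oner_neq0 // val_1 //.
  by rewrite val_exp //; have := mulrn_upper r.+1 wz1; lia.
have [d0 vd] := pole v vP vz; have [_ wd] := pole (w i) wP wiz0.
exists (a * (z ^+ r.+1 / (z ^+ r.+1 + 1))); split.
- by rewrite !mulf_neq0 ?invr_eq0.
- rewrite val_mul ?mulf_neq0 ?invr_eq0 // val_div // vd; lia.
move=> j; rewrite inE => /orP[/eqP->|js].
  rewrite val_mul ?mulf_neq0 ?invr_eq0 // val_div // wd; lia.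
have wj := wjP j js; have wzj := wz j js.
have [_] : 1 + z ^+ r.+1 != 0 /\ w j (1 + z ^+ r.+1) = w j 1.
  apply: val_dominant; rewrite ?oner_neq0 // val_1 // vgeE // val_exp //.
  by have := mulrn_lower r.+1 wzj; lia.
rewrite addrC val_1 // => wj1.
rewrite val_mul ?mulf_neq0 ?invr_eq0 // val_div // wj1 subr0 val_exp //.
exact: hr.
Qed.
End WeakApproximation.

(** * Power series and Hensel's lemma *)

Section PowerSeries.
Variable K : fieldType.

Record pseries := PSeries { pcoef : nat -> K }.

HB.instance Definition _ := gen_eqMixin pseries.
HB.instance Definition _ := gen_choiceMixin pseries.

Implicit Types a b c : pseries.

Lemma pseriesP a b : (forall n, pcoef a n = pcoef b n) -> a = b.
Proof. by case: a b => a [b] /= h; congr PSeries; apply/funext. Qed.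

Definition poly_pseries (p : {poly K}) := PSeries (fun i => p`_i).
Definition truncation n a : {poly K} := \poly_(i < n) pcoef a i.

Definition padd a b := PSeries (fun n => pcoef a n + pcoef b n).
Definition popp a := PSeries (fun n => - pcoef a n).
(** The Cauchy product, read off from truncations so that the ring laws are inherited from
    polynomials by way of [agree]. *)
Definition pmul a b := PSeries (fun n => (truncation n.+1 a * truncation n.+1 b)`_n).

Definition agree n (p : {poly K}) a := forall i, (i <= n)%N -> p`_i = pcoef a i.

Lemma agree_truncation n a : agree n (truncation n.+1 a) a.
Proof. by move=> i le_in; rewrite coef_poly ltnS le_in. Qed.

Lemma agree_poly n p : agree n p (poly_pseries p).
Proof. by []. Qed.

Lemma agree_mul n p q a b : agree n p a -> agree n q b -> agree n (p * q) (pmul a b).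
Proof.
move=> pa qb i le_in /=; rewrite !coefM; apply: eq_bigr => -[j ltji] _ /=.
have ji : (j <= i)%N by rewrite -ltnS.
rewrite pa ?(leq_trans ji) // qb ?(leq_trans (leq_subr _ _)) //.
by rewrite !agree_truncation ?leq_subr.
Qed.

Lemma padd_A : associative padd.
Proof. by move=> a b c; apply: pseriesP => n; rewrite /= addrA. Qed.
Lemma padd_C : commutative padd.
Proof. by move=> a b; apply: pseriesP => n; rewrite /= addrC. Qed.
Lemma padd_0 : left_id (poly_pseries 0) padd.
Proof. by move=> a; apply: pseriesP => n; rewrite /= coef0 add0r. Qed.
Lemma padd_N : left_inverse (poly_pseries 0) popp padd.
Proof. by move=> a; apply: pseriesP => n; rewrite /= coef0 addNr. Qed.

HB.instance Definition _ := GRing.isZmodule.Build pseries padd_A padd_C padd_0 padd_N.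

Lemma agree_add n p q a b : agree n p a -> agree n q b -> agree n (p + q) (a + b).
Proof. by move=> pa qb i le_in; rewrite coefD pa // qb. Qed.

Lemma pmul_A : associative pmul.
Proof.
move=> a b c; apply: pseriesP => n.
have [ha hb hc] := And3 (@agree_truncation n a) (@agree_truncation n b) (@agree_truncation n c).
rewrite -(agree_mul ha (agree_mul hb hc) (leqnn n)).
by rewrite -(agree_mul (agree_mul ha hb) hc (leqnn n)) mulrA.
Qed.
Lemma pmul_C : commutative pmul.
Proof. by move=> a b; apply: pseriesP => n; rewrite /= mulrC. Qed.
Lemma pmul_1 : left_id (poly_pseries 1) pmul.
Proof.
move=> a; apply: pseriesP => n; have ha := @agree_truncation n a.
by rewrite -(agree_mul (@agree_poly n 1) ha (leqnn n)) mul1r ha.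
Qed.
Lemma pmul_D : left_distributive pmul +%R.
Proof.
move=> a b c; apply: pseriesP => n.
have [ha hb hc] := And3 (@agree_truncation n a) (@agree_truncation n b) (@agree_truncation n c).
rewrite -(agree_mul (agree_add ha hb) hc (leqnn n)).
by rewrite -(agree_add (agree_mul ha hc) (agree_mul hb hc) (leqnn n)) mulrDl.
Qed.
Lemma pone_neq0 : poly_pseries 1 != 0.
Proof. by apply/eqP => /(congr1 (pcoef^~ 0%N)) /eqP; rewrite /= !coefE oner_eq0. Qed.

HB.instance Definition _ := GRing.Zmodule_isComNzRing.Build pseries
  pmul_A pmul_C pmul_1 pmul_D pone_neq0.

Lemma pcoefD a b n : pcoef (a + b) n = pcoef a n + pcoef b n. Proof. by []. Qed.
Lemma pcoefN a n : pcoef (- a) n = - pcoef a n. Proof. by []. Qed.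
Lemma pcoef0 n : pcoef 0 n = 0. Proof. by rewrite /= coef0. Qed.
Lemma pcoefM a b n : pcoef (a * b) n = \sum_(i < n.+1) pcoef a i * pcoef b (n - i).
Proof.
rewrite /= coefM; apply: eq_bigr => -[i /= ltin] _.
by rewrite !agree_truncation ?leq_subr // -ltnS.
Qed.

Lemma poly_pseries_is_zmod_morphism : zmod_morphism poly_pseries.
Proof. by move=> p q; apply: pseriesP => n; rewrite /= coefB. Qed.
Lemma poly_pseries_is_monoid_morphism : monoid_morphism poly_pseries.
Proof.
split=> // p q; apply: pseriesP => n.
by rewrite -(agree_mul (@agree_poly n p) (@agree_poly n q) (leqnn n)).
Qed.
HB.instance Definition _ := GRing.isZmodMorphism.Build {poly K} pseries
  poly_pseries poly_pseries_is_zmod_morphism.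
HB.instance Definition _ := GRing.isMonoidMorphism.Build {poly K} pseries
  poly_pseries poly_pseries_is_monoid_morphism.

(** The substitution [t -> z t]. *)
Definition dilate (z : K) a := PSeries (fun n => z ^+ n * pcoef a n).

Lemma dilate_is_zmod_morphism z : zmod_morphism (dilate z).
Proof. by move=> a b; apply: pseriesP => n; rewrite /= mulrBr. Qed.
Lemma dilate_is_monoid_morphism z : monoid_morphism (dilate z).
Proof.
split=> [|a b]; apply: pseriesP => n.
  by rewrite /= coef1; case: n => [|n]; rewrite ?expr0 ?mulr1 ?mulr0.
have dE x : pcoef (dilate z x) n = z ^+ n * pcoef x n by [].
rewrite dE !pcoefM mulr_sumr; apply: eq_bigr => -[i /= ltin] _.
by rewrite mulrACA -exprD subnKC.
Qed.
HB.instance Definition _ z := GRing.isZmodMorphism.Build pseries pseries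
  (dilate z) (dilate_is_zmod_morphism z).
HB.instance Definition _ z := GRing.isMonoidMorphism.Build pseries pseries
  (dilate z) (dilate_is_monoid_morphism z).

Definition constant_term a := pcoef a 0.
Lemma constant_term_is_zmod_morphism : zmod_morphism constant_term.
Proof. by []. Qed.
Lemma constant_term_is_monoid_morphism : monoid_morphism constant_term.
Proof.
split=> [|a b]; first by rewrite /constant_term /= coef1.
by rewrite /constant_term pcoefM big_ord_recl big_ord0 addr0 subn0.
Qed.
HB.instance Definition _ := GRing.isZmodMorphism.Build pseries K
  constant_term constant_term_is_zmod_morphism.
HB.instance Definition _ := GRing.isMonoidMorphism.Build pseries K
  constant_term constant_term_is_monoid_morphism.

Definition ord_ge n a := forall i, (i < n)%N -> pcoef a i = 0.

Lemma ord_ge0 a : ord_ge 0 a. Proof. by []. Qed.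

Lemma ord_geD n a b : ord_ge n a -> ord_ge n b -> ord_ge n (a + b).
Proof. by move=> ha hb i lin; rewrite pcoefD ha // hb // addr0. Qed.

Lemma ord_geW m n a : (m <= n)%N -> ord_ge n a -> ord_ge m a.
Proof. by move=> mn ha i lim; apply: ha; apply: leq_trans mn. Qed.

Lemma ord_geM m n a b : ord_ge m a -> ord_ge n b ->
  ord_ge (m + n) (a * b) /\ pcoef (a * b) (m + n) = pcoef a m * pcoef b n.
Proof.
move=> ha hb; split=> [i lin|].
  rewrite pcoefM big1 // => j _; have [jm|mj] := ltnP j m.
    by rewrite ha // mul0r.
  by rewrite hb ?mulr0 //; have := ltn_ord j; lia.
have mlt : (m < (m + n).+1)%N by lia.
rewrite pcoefM (bigD1 (Ordinal mlt)) //= big1 ?addr0; first by rewrite addKn.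
move=> [j jlt] /=; rewrite -val_eqE /= => jm; have [jltm|mj] := ltnP j m.
  by rewrite ha // mul0r.
by rewrite hb ?mulr0 //; lia.
Qed.

Lemma pseries_neq0P a : a != 0 -> exists n, ord_ge n a /\ pcoef a n != 0.
Proof.
move=> a0; have ex : exists n, pcoef a n != 0.
  apply: contrapT => h; case/eqP: a0; apply: pseriesP => n; rewrite pcoef0.
  by apply/eqP/negPn/negP => an; apply: h; exists n.
case: (ex_minnP ex) => n an min; exists n; split=> // i lin.
by apply/eqP; apply: contraTT lin => /min; rewrite -leqNgt.
Qed.

Lemma pseries_integral a b : a * b = 0 -> (a == 0) || (b == 0).
Proof.
move=> ab0; apply: contraT; rewrite negb_or => /andP[].
move=> /pseries_neq0P[m [ha am]] /pseries_neq0P[n [hb bn]].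
have [_] := ord_geM ha hb; rewrite ab0 pcoef0 => /esym/eqP.
by rewrite mulf_eq0 (negPf am) (negPf bn).
Qed.

Definition pseries_unit : {pred pseries} := fun x => `[< exists y, y * x = 1 >].
Definition pseries_inv (x : pseries) : pseries :=
  if pselect (exists y, y * x = 1) is left h then sval (cid h) else x.

Lemma pseries_mulVx : {in pseries_unit, left_inverse 1 pseries_inv *%R}.
Proof.
move=> x /asboolP h; rewrite /pseries_inv; case: pselect => // h'; by case: cid.
Qed.
Lemma pseries_unitPl x y : y * x = 1 -> pseries_unit x.
Proof. by move=> h; apply/asboolP; exists y. Qed.
Lemma pseries_inv_out : {in [predC pseries_unit], pseries_inv =1 id}.
Proof.
move=> x /negP h; rewrite /pseries_inv; case: pselect => // h'.
by case: h; apply/asboolP.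
Qed.

HB.instance Definition _ := GRing.ComNzRing_hasMulInverse.Build pseries
  pseries_mulVx pseries_unitPl pseries_inv_out.
HB.instance Definition _ := GRing.ComUnitRing_isIntegral.Build pseries pseries_integral.

Definition pord a : nat :=
  if pselect (exists n, ord_ge n a /\ pcoef a n != 0) is left h then sval (cid h) else 0.

Lemma pordP a : a != 0 -> ord_ge (pord a) a /\ pcoef a (pord a) != 0.
Proof.
by move=> /pseries_neq0P h; rewrite /pord; case: pselect => // h'; case: cid.
Qed.

Lemma pord_unique n a : ord_ge n a -> pcoef a n != 0 -> a != 0 /\ pord a = n.
Proof.
move=> ha an; have a0 : a != 0.
  by apply: contraNneq an => ->; rewrite pcoef0.
split=> //; have [h1 h2] := pordP a0; apply/eqP; rewrite eqn_leq.
apply/andP; split; rewrite leqNgt; apply/negP => lt.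
  by rewrite h1 // eqxx in an.
by rewrite ha // eqxx in h2.
Qed.

Lemma ord_geE n a : a != 0 -> ord_ge n a -> (n <= pord a)%N.
Proof.
move=> a0 ha; rewrite leqNgt; apply/negP => lt.
by have [_] := pordP a0; rewrite ha ?eqxx.
Qed.

Lemma pordM a b : a != 0 -> b != 0 -> pord (a * b) = (pord a + pord b)%N.
Proof.
move=> /pordP[ha an] /pordP[hb bn]; have [h e] := ord_geM ha hb.
by have [] := pord_unique h; rewrite // e mulf_neq0.
Qed.

Lemma pordD a b : a != 0 -> b != 0 -> a + b != 0 ->
  (minn (pord a) (pord b) <= pord (a + b)%R)%N.
Proof.
move=> /pordP[ha _] /pordP[hb _] ab0; apply: ord_geE => //.
by apply: ord_geD; [apply: ord_geW ha|apply: ord_geW hb]; rewrite ?geq_minl ?geq_minr.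
Qed.

End PowerSeries.

Lemma horner_taylor2 (R : comNzRingType) (H : {poly R}) x d :
  exists s, H.[x + d] = H.[x] + H^`().[x] * d + d ^+ 2 * s.
Proof.
elim/poly_ind: H => [|H c [s IH]].
  by exists 0; rewrite deriv0 !horner0 mul0r mulr0 !addr0.
exists (s * (x + d) + H^`().[x]).
rewrite derivD derivM derivX derivC !hornerE IH; ring.
Qed.

Section Hensel.
Variables (K : fieldType) (H : {poly pseries K}) (c : K).
Let C (x : K) : pseries K := poly_pseries x%:P.
Hypothesis root_c : constant_term H.[C c] = 0.
Hypothesis simple_c : constant_term H^`().[C c] != 0.

(** A linearly convergent Newton iteration: step [n] only sets the coefficient of [t^n], and the
    divisor stays the constant term of the derivative at [c], which [newton_deriv] shows to be the
    same at every approximation. *)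
Fixpoint newton n : {poly K} :=
  if n is n'.+1 then newton n'
    - (pcoef H.[poly_pseries (newton n')] n / constant_term H^`().[C c]) *: 'X^n
  else c%:P.

Let q n := poly_pseries (newton n).

Lemma ord_ge_Xn e n : ord_ge n (poly_pseries (e *: 'X^n) : pseries K).
Proof. by move=> i lin; rewrite /= coefZ coefXn ltn_eqF // mulr0. Qed.

Lemma newton_constant n : constant_term (q n) = c.
Proof.
elim: n => [|n IH]; first by rewrite /constant_term /= coefC.
by rewrite -[RHS]IH /q /constant_term /= coefB coefZ coefXn mulr0 subr0.
Qed.

Lemma newton_deriv n : constant_term H^`().[q n] = constant_term H^`().[C c].
Proof.
rewrite -!horner_map; congr (_.[_]).
by rewrite [LHS]newton_constant /constant_term /= coefC.
Qed.

Lemma newton_root n : ord_ge n.+1 H.[q n].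
Proof.
elim: n => [|n IH]; first by case.
set e := pcoef H.[q n] n.+1 / constant_term H^`().[C c].
pose m : {poly K} := (- e) *: 'X^(n.+1).
have qE : q n.+1 = q n + poly_pseries m.
  by rewrite /q /= -rmorphD /= /m scaleNr.
have [s hs] := horner_taylor2 H (q n) (poly_pseries m).
have hd : ord_ge n.+1 (poly_pseries m) := @ord_ge_Xn _ _.
move=> i; rewrite ltnS => lin; rewrite qE hs !pcoefD.
(* The quadratic remainder has order at least [2 n + 2], above every [i] in question; at [i = n + 1]
   the linear term cancels the error by the choice of [e]. *)
have -> : pcoef (poly_pseries m ^+ 2 * s) i = 0.
  have [+ _] := ord_geM (ord_geM hd hd).1 (@ord_ge0 _ s).
  by rewrite -expr2; apply; lia.
have [hl heq] := ord_geM (@ord_ge0 _ H^`().[q n]) hd.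
have [->|iin] := eqVneq i n.+1; last first.
  by rewrite IH ?hl ?add0r ?addr0 //; lia.
rewrite addr0; move: heq; rewrite add0n => ->.
rewrite -/(constant_term _) newton_deriv /= coefZ coefXn eqxx mulr1 mulrN.
by rewrite mulrC divfK // subrr.
Qed.

Lemma newton_stable n i : (i <= n)%N -> (newton n)`_i = (newton i)`_i.
Proof.
elim: n => [|n IH]; first by rewrite leqn0 => /eqP->.
rewrite leq_eqVlt => /orP[/eqP->//|lin].
by rewrite /= coefB coefZ coefXn ltn_eqF // mulr0 subr0 IH.
Qed.

Lemma hensel : exists V : pseries K, H.[V] = 0 /\ constant_term V = c.
Proof.
exists (PSeries (fun n => (newton n)`_n)); split; last first.
  by rewrite /constant_term /= coefC.
set V := PSeries _; apply: pseriesP => n; rewrite pcoef0.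
(* [V] and [q n] agree through [t^n], so by Taylor expansion [H.[V]] and [H.[q n]] have the same
   coefficient at [n]. *)
have hd : ord_ge n.+1 (V - q n).
  by move=> i; rewrite ltnS => lin; rewrite pcoefD pcoefN /= (newton_stable lin) subrr.
have [s hs] := horner_taylor2 H (q n) (V - q n).
move: hs; rewrite addrC subrK => ->; rewrite !pcoefD.
rewrite (newton_root (ltnSn n)) add0r.
have [+ _] := ord_geM (@ord_ge0 _ H^`().[q n]) hd; rewrite add0n => ->; last by [].
have [+ _] := ord_geM (ord_geM hd hd).1 (@ord_ge0 _ s).
by rewrite -expr2 add0r; apply; lia.
Qed.
End Hensel.

(** * Fraction fields and Laurent series *)

Section Fractions.
Variable R : idomainType.
Local Notation tofrac := (@tofrac R).

Lemma fraction_numden (z : {fraction R}) :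
  exists a b, b != 0 /\ z = tofrac a / tofrac b.
Proof.
elim/quotW: z => x; exists (frac x).1, (frac x).2; split; first exact: denom_ratioP.
have d0 : tofrac (frac x).2 != 0 by rewrite tofrac_eq0 denom_ratioP.
apply: (mulIf d0); rewrite divfK //.
unlock tofrac; rewrite -[LHS]FracField.pi_mul; apply/eqmodP.
rewrite /= FracField.equivfE /FracField.mulf.
by rewrite !numden_Ratio ?mulr1 ?oner_neq0 ?denom_ratioP ?mulf_neq0 // mulrC.
Qed.

Lemma fraction_eq a b c d : b != 0 -> d != 0 ->
  tofrac a / tofrac b = tofrac c / tofrac d -> a * d = c * b.
Proof.
move=> b0 d0 /eqP; rewrite eqr_div ?tofrac_eq0 // -!tofracM tofrac_eq.
by move=> /eqP.
Qed.

Lemma fraction_lift (S : fieldType) (phi : {rmorphism R -> S}) : injective phi ->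
  exists psi : {rmorphism {fraction R} -> S}, forall a, psi (tofrac a) = phi a.
Proof.
move=> phi_inj.
have phi0 a : a != 0 -> phi a != 0 by rewrite -(rmorph0 phi) (inj_eq phi_inj).
have [psi psiE] : exists psi : {fraction R} -> S,
    forall a b, b != 0 -> psi (tofrac a / tofrac b) = phi a / phi b.
  have ex z : {p : R * R | p.2 != 0 /\ z = tofrac p.1 / tofrac p.2}.
    apply: cid; have [a [b h]] := fraction_numden z.
    by exists (a, b).
  exists (fun z => phi (sval (ex z)).1 / phi (sval (ex z)).2) => a b b0.
  case: ex => -[c d] /= [d0 /(fraction_eq b0 d0) e].
  by apply/eqP; rewrite eqr_div ?phi0 // -!rmorphM e.
have psi_tofrac a : psi (tofrac a) = phi a.
  by have := psiE a 1 (oner_neq0 _); rewrite !rmorph1 !divr1.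
have psiB : zmod_morphism psi.
  move=> x y; have [a [b [b0 ->]]] := fraction_numden x.
  have [c [d [d0 ->]]] := fraction_numden y.
  rewrite -mulNr addf_div ?tofrac_eq0 // -tofracN -!tofracM -tofracD.
  rewrite !psiE ?mulf_neq0 // rmorphD !rmorphM rmorphN.
  by rewrite -addf_div ?phi0 // mulNr.
have psiM : monoid_morphism psi.
  split=> [|x y]; first by rewrite -tofrac1 psi_tofrac rmorph1.
  have [a [b [b0 ->]]] := fraction_numden x.
  have [c [d [d0 ->]]] := fraction_numden y.
  rewrite mulf_div -!tofracM !psiE ?mulf_neq0 // !rmorphM.
  by rewrite mulf_div.
pose psiH : {rmorphism {fraction R} -> S} := HB.pack psi
  (GRing.isZmodMorphism.Build _ _ psi psiB) (GRing.isMonoidMorphism.Build _ _ psi psiM).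
by exists psiH.
Qed.

Lemma rmorph_fraction_eq (S : fieldType) (f g : {rmorphism {fraction R} -> S}) :
  (forall a, f (tofrac a) = g (tofrac a)) -> f =1 g.
Proof.
move=> fg z; have [a [b [b0 ->]]] := fraction_numden z.
by rewrite !fmorph_div !fg.
Qed.
End Fractions.

Section LaurentSeries.
Variable K : fieldType.

Definition laurent : fieldType := {fraction pseries K}.
Implicit Types x y : laurent.

Definition series_const (c : K) : laurent := tofrac (poly_pseries c%:P).
HB.instance Definition _ := GRing.RMorphism.copy series_const
  (@tofrac (pseries K) \o (@poly_pseries K) \o polyC).
Definition series_t : laurent := tofrac (poly_pseries 'X).

Definition laurent_ord x : int :=
  let p := cid (fraction_numden x) in let q := cid (svalP p) in
  (pord (sval p))%:Z - (pord (sval q))%:Z.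

Lemma laurent_ordE (a b : pseries K) : a != 0 -> b != 0 ->
  laurent_ord (tofrac a / tofrac b) = (pord a)%:Z - (pord b)%:Z.
Proof.
move=> a0 b0; rewrite /laurent_ord; case: cid => c /= h.
case: cid => d /= [d0 /(fraction_eq b0 d0) e].
have c0 : c != 0.
  apply: contraTneq (mulf_neq0 a0 d0) => c0; rewrite e c0 mul0r eqxx //.
have := congr1 (@pord K) e; rewrite !pordM //; lia.
Qed.

Lemma laurent_ord_tofrac (a : pseries K) : a != 0 -> laurent_ord (tofrac a) = pord a.
Proof.
move=> a0; have := laurent_ordE a0 (oner_neq0 _); rewrite tofrac1 divr1 => ->.
have h0 : ord_ge 0 (1 : pseries K) by case.
by have [|_ ->] := pord_unique h0; rewrite ?subr0 //= coef1 oner_neq0.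
Qed.

Lemma laurent_numden x : x != 0 ->
  exists a b : pseries K, [/\ a != 0, b != 0 & x = tofrac a / tofrac b].
Proof.
have [a [b [b0 ->]]] := fraction_numden x => x0; exists a, b; split=> //.
by apply: contraNneq x0 => ->; rewrite tofrac0 mul0r.
Qed.

Lemma laurent_ord_valuation : valuation laurent_ord.
Proof.
split=> x y /laurent_numden[a [b [a0 b0 ->]]] /laurent_numden[c [d [c0 d0 ->]]].
  rewrite mulf_div -!tofracM !laurent_ordE ?mulf_neq0 // !pordM //; lia.
rewrite addf_div ?tofrac_eq0 // -!tofracM -tofracD => s0.
have n0 : a * d + c * b != 0.
  by apply: contraNneq s0 => ->; rewrite tofrac0 mul0r.
rewrite !laurent_ordE ?mulf_neq0 //.
have := pordD (mulf_neq0 a0 d0) (mulf_neq0 c0 b0) n0; rewrite !pordM //.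
rewrite ge_min => h; apply/orP; move: (pord (a * d + c * b)) h => s h; lia.
Qed.
Let ordP := laurent_ord_valuation.

Lemma laurent_ord_const c : c != 0 -> laurent_ord (series_const c) = 0.
Proof.
move=> c0; have h0 : ord_ge 0 (poly_pseries c%:P) by case.
have [|s0 so] := pord_unique h0; first by rewrite /= coefC.
by rewrite laurent_ord_tofrac // so.
Qed.

Lemma series_t_ord : series_t != 0 /\ laurent_ord series_t = 1.
Proof.
have h0 : ord_ge 1 (poly_pseries 'X : pseries K) by move=> [|//] _; rewrite /= coefX.
have [|s0 so] := pord_unique h0; first by rewrite /= coefX oner_neq0.
by rewrite tofrac_eq0 s0 laurent_ord_tofrac // so.
Qed.

Lemma vge_tofrac n a : ord_ge n a -> vge laurent_ord n (tofrac a).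
Proof.
have [->|a0] := eqVneq a 0; first by rewrite tofrac0 vge0.
by rewrite vgeE ?tofrac_eq0 // laurent_ord_tofrac // => /(ord_geE a0); lia.
Qed.

(** The residue is the quotient of the leading coefficients of numerator and denominator. *)
Lemma laurent_residue x : x != 0 -> laurent_ord x = 0 ->
  exists2 c, c != 0 & vge laurent_ord 1 (x - series_const c).
Proof.
move=> /laurent_numden[a [b [a0 b0 ->]]]; rewrite laurent_ordE // => e.
have {e}e : pord a = pord b by lia.
have [ha an] := pordP a0; have [hb bn] := pordP b0.
have bF : tofrac b != 0 by rewrite tofrac_eq0.
set c := pcoef a (pord a) / pcoef b (pord b); exists c.
  by rewrite mulf_neq0 ?invr_eq0.
have -> : tofrac a / tofrac b - series_const c =
    tofrac (a - poly_pseries c%:P * b) / tofrac b.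
  by rewrite tofracB tofracM mulrBl mulfK.
apply: (@vgeW _ _ _ ((pord b).+1%:Z + laurent_ord (tofrac b)^-1)).
  by rewrite val_inv // laurent_ord_tofrac //; lia.
apply: vgeM; rewrite ?vge_val //; apply: vge_tofrac => i.
have := ord_geM (@ord_ge0 _ (poly_pseries c%:P)) hb; rewrite add0n => -[h1 h2].
rewrite ltnS leq_eqVlt => /orP[/eqP->|lt]; rewrite pcoefD pcoefN; last first.
  by rewrite h1 // ha ?e // subrr.
by rewrite h2 /= coefC /c divfK // e subrr.
Qed.

(** When [z^N = 1] this substitution fixes [t^-N], hence the image of [K(X)], and composing with it
    turns one embedding into another with the same place. *)
Lemma laurent_dilation (z : K) : z != 0 ->
  exists A : {rmorphism laurent -> laurent},
    [/\ forall c, A (series_const c) = series_const c, A series_t = series_const z * series_t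
      & forall x, x != 0 -> laurent_ord (A x) = laurent_ord x].
Proof.
move=> z0; have dil_inj : injective (dilate z).
  move=> a b h; apply: pseriesP => n; have := congr1 (@pcoef K ^~ n) h => /=.
  by apply: mulfI; rewrite expf_neq0.
have inj : injective (@tofrac (pseries K) \o dilate z).
  by move=> a b /eqP; rewrite /= tofrac_eq => /eqP/dil_inj.
have [A AE] := fraction_lift inj; exists A; split.
- move=> c; rewrite [LHS]AE; congr tofrac; apply: pseriesP => n /=.
  by rewrite coefC; case: n => [|n]; rewrite ?mul1r ?mulr0.
- rewrite [LHS]AE /= /series_t /series_const -tofracM -rmorphM; congr tofrac.
  apply: pseriesP => n /=.
  by rewrite coefCM coefX; case: n => [|[|n]]; rewrite ?mulr0.
have dil_ord a : a != 0 -> dilate z a != 0 /\ pord (dilate z a) = pord a.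
  move=> /pordP[ha an]; apply: pord_unique.
    by move=> i /ha /= ->; rewrite mulr0.
  by rewrite /= mulf_neq0 ?expf_neq0.
move=> x /laurent_numden[a [b [a0 b0 ->]]].
have [ea oa] := dil_ord a a0; have [eb ob] := dil_ord b b0.
by rewrite fmorph_div !AE !laurent_ordE // oa ob.
Qed.

End LaurentSeries.

(** * Simple extensions and their conjugates *)

Definition subfield_closed (L : fieldType) (S : set L) : Prop :=
  [/\ S 1, forall x y, S x -> S y -> S (x - y) & forall x y, S x -> S y -> S (x / y)].

Lemma rmorph_range_subfield (E L : fieldType) (j : {rmorphism E -> L}) :
  subfield_closed (fun x => exists e, x = j e).
Proof.
split; first by exists 1; rewrite rmorph1.
  by move=> _ _ [x ->] [y ->]; exists (x - y); rewrite rmorphB.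
by move=> _ _ [x ->] [y ->]; exists (x / y); rewrite fmorph_div.
Qed.

Section MinimalPolynomial.
Variables (F L : fieldType) (iota : {rmorphism F -> L}).

Definition minimal_poly (theta : L) (mu : {poly F}) : Prop :=
  mu \is monic /\ forall p, root (map_poly iota p) theta = (mu %| p).

Lemma minimal_poly_exists theta : algebraicOver iota theta ->
  exists mu, minimal_poly theta mu.
Proof.
move=> [p p0 pr].
have ex : exists n, `[< exists q, [/\ q != 0, root (map_poly iota q) theta & size q = n] >].
  by exists (size p); apply/asboolP; exists p.
case: (ex_minnP ex) => n /asboolP[q [q0 qr sq]] min.
have lq : lead_coef q != 0 by rewrite lead_coef_eq0.
exists ((lead_coef q)^-1 *: q); split.
  by rewrite monicE lead_coefZ mulVf.
move=> s; rewrite dvdpZl ?invr_eq0 //.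
have sE : root (map_poly iota s) theta = root (map_poly iota (s %% q)) theta.
  rewrite {1}(divp_eq s q) rmorphD rmorphM /= !rootE hornerD hornerM.
  by rewrite (eqP qr) mulr0 add0r.
rewrite sE /dvdp; have [->|r0] := eqVneq (s %% q) 0.
  by rewrite rmorph0 root0.
apply/negbTE/negP => rr; have := min (size (s %% q)); rewrite leqNgt -sq ltn_modp q0.
by move=> /(_ _)/negP; apply => //; apply/asboolP; exists (s %% q).
Qed.

Variables (theta : L) (mu : {poly F}).
Hypothesis muP : minimal_poly theta mu.

Lemma minimal_poly_root : root (map_poly iota mu) theta.
Proof. by rewrite muP.2. Qed.

Lemma minimal_poly_size : (1 < size mu)%N.
Proof.
rewrite ltnNge; apply/negP => /size1_polyC e; have := minimal_poly_root.
rewrite e map_polyC rootC fmorph_eq0 => /eqP c0.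
by have := monic_neq0 muP.1; rewrite e c0 eqxx.
Qed.

(** Irreducibility: in [mu = h * gcdp mu p], [theta] is a root of one factor. If of the gcd, then
    [mu] divides [p]; if of [h], then [h] has full size and the gcd is constant. *)
Lemma minimal_poly_coprime p : ~~ (mu %| p) -> coprimep mu p.
Proof.
move=> np; have /dvdpP[h hE] := dvdp_gcdl mu p.
have := minimal_poly_root; rewrite {1}hE rmorphM rootM !muP.2 => /orP[dh|dg]; last first.
  by case/negP: np; apply: dvdp_trans dg (dvdp_gcdr _ _).
have mu0 := monic_neq0 muP.1.
have := mu0; rewrite {1}hE mulf_eq0 negb_or => /andP[h0 g0].
have := dvdp_leq h0 dh; rewrite {1}hE size_mul // /coprimep.
have := size_poly_gt0 h; have := size_poly_gt0 (gcdp mu p); rewrite h0 g0; lia.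
Qed.

Lemma minimal_poly_separable : [pchar F] =i pred0 -> separable_poly mu.
Proof.
move=> /pcharf0P ch; rewrite unlock; apply: minimal_poly_coprime.
have sm := minimal_poly_size; have m0 := monic_neq0 muP.1.
have d0 : mu^`() != 0.
  apply/eqP => /(congr1 (fun p : {poly F} => p`_(size mu).-2)) /eqP.
  rewrite coef_deriv coef0 -mulr_natr mulf_eq0 ch.
  have -> : (size mu).-2.+1 = (size mu).-1 by lia.
  have := muP.1; rewrite monicE lead_coefE => /eqP ->; by rewrite oner_eq0 /= -subn1 subn_eq0 leqNgt sm.
by apply/negP => /(dvdp_leq d0); rewrite leqNgt lt_size_deriv.
Qed.

Lemma minimal_poly_subfield :
  subfield_closed (fun z => exists p, z = (map_poly iota p).[theta]).
Proof.
split; first by exists 1; rewrite rmorph1 hornerC.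
  by move=> _ _ [p ->] [q ->]; exists (p - q); rewrite rmorphB !hornerE.
move=> _ _ [p ->] [q ->]; have [qr|qr] := boolP (mu %| q).
  exists 0; rewrite rmorph0 horner0; move: qr; rewrite -muP.2 => /eqP ->.
  by rewrite invr0 mulr0.
(* The Bezout cofactor [w] takes at [theta] the inverse value of [q]. *)
have /Bezout_eq1_coprimepP[[u w] /= e] := minimal_poly_coprime qr.
exists (p * w); have q0 : (map_poly iota q).[theta] != 0 by rewrite -rootE muP.2.
apply: (mulIf q0); rewrite divfK // -hornerM -rmorphM /= -mulrA.
have e' : p = p * u * mu + p * (w * q) by rewrite -mulrA -mulrDr e mulr1.
rewrite {1}e' rmorphD /= hornerD (rmorphM _ (p * u)) /= hornerM.
by rewrite (eqP minimal_poly_root) mulr0 add0r.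
Qed.
End MinimalPolynomial.

Section SimpleExtension.
Variables (F L : fieldType) (iota : {rmorphism F -> L}).

Definition simple_extension (theta : L) (mu : {poly F}) : Prop :=
  minimal_poly iota theta mu /\ forall z, exists p, z = (map_poly iota p).[theta].

(** Phrased as an induction principle, since it is applied to preimages of subfields and to the
    locus where two embeddings agree. *)
Definition generates (ys : seq L) : Prop := forall S : set L, subfield_closed S ->
  (forall c, S (iota c)) -> (forall y, y \in ys -> S y) -> forall z, S z.

Lemma primitive_element (ys : seq L) : [pchar F] =i pred0 ->
    (forall y, y \in ys -> algebraicOver iota y) ->
  exists2 theta, algebraicOver iota theta &
    forall y, y \in ys -> exists p, y = (map_poly iota p).[theta].
Proof.
move=> ch; elim: ys => [_|y ys IH alg]; first by exists 0 => //; apply: algebraic0.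
have [|th [p p0 pr] hth] := IH; first by move=> z zs; apply: alg; rewrite inE zs orbT.
have ay := alg y (mem_head _ _); have [q q0 qr] := ay.
have [n [[px hx] [py hy]]] := pchar0_PET p0 pr q0 qr ch.
exists (y *+ n - th).
  apply: algebraic_sub; last by exists p.
  rewrite -mulr_natr; apply: algebraic_mul => //.
  by rewrite -(rmorph_nat iota); apply: algebraic_id.
move=> z; rewrite inE => /orP[/eqP->|/hth[s ->]]; first by exists py; rewrite hy.
by exists (s \Po px); rewrite map_comp_poly horner_comp hx.
Qed.

Lemma simple_extension_exists (ys : seq L) : [pchar F] =i pred0 ->
    (forall y, y \in ys -> algebraicOver iota y) -> generates ys ->
  exists theta mu, simple_extension theta mu.
Proof.
move=> ch alg gen; have [th ath hth] := primitive_element ch alg.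
have [mu muP] := minimal_poly_exists ath; exists th, mu; split=> //.
apply: gen => //; first exact: minimal_poly_subfield muP.
by move=> c; exists c%:P; rewrite map_polyC hornerC.
Qed.

Variables (theta : L) (mu : {poly F}).
Hypothesis ext : simple_extension theta mu.
Let muP := ext.1.

(** [p(theta)] is sent to [p(theta')]; two representing polynomials differ by a multiple of [mu],
    which vanishes at [theta']. *)
Lemma simple_extension_embedding (E : fieldType) (kappa : {rmorphism F -> E}) theta' :
    root (map_poly kappa mu) theta' ->
  exists sigma : {rmorphism L -> E}, (forall c, sigma (iota c) = kappa c) /\
    sigma theta = theta'.
Proof.
move=> r'; pose rep z := sval (cid (ext.2 z)).
have repP z : z = (map_poly iota (rep z)).[theta] by rewrite /rep; case: cid.
pose s z := (map_poly kappa (rep z)).[theta'].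
have sE p : s (map_poly iota p).[theta] = (map_poly kappa p).[theta'].
  apply/eqP; rewrite -subr_eq0 /s -hornerN -hornerD -rmorphB /= -rootE.
  set q := rep _ - p; have : mu %| q.
    by rewrite -muP.2 /q rmorphB /= rootE hornerD hornerN -repP subrr.
  by move=> /dvdpP[u ->]; rewrite rmorphM rootM r' orbT.
have sB : zmod_morphism s.
  move=> x y; rewrite (repP x) (repP y) -hornerN -hornerD -rmorphB /= !sE.
  by rewrite rmorphB hornerD hornerN.
have sM : monoid_morphism s.
  split=> [|x y].
    by have := sE 1; rewrite !rmorph1 !hornerC.
  by rewrite (repP x) (repP y) -hornerM -rmorphM /= !sE rmorphM hornerM.
pose sigma : {rmorphism L -> E} := HB.pack s
  (GRing.isZmodMorphism.Build _ _ s sB) (GRing.isMonoidMorphism.Build _ _ s sM).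
exists sigma; split=> [c|].
  by have := sE c%:P; rewrite !map_polyC !hornerC.
by have := sE 'X; rewrite !map_polyX !hornerX.
Qed.

Lemma simple_extension_eq (E : fieldType) (s1 s2 : {rmorphism L -> E}) :
  (forall c, s1 (iota c) = s2 (iota c)) -> s1 theta = s2 theta -> s1 =1 s2.
Proof.
move=> hc ht z; have [p ->] := ext.2 z.
rewrite -!horner_map -!map_poly_comp /= ht; congr (_.[_]).
by apply: eq_map_poly => c /=.
Qed.
End SimpleExtension.

(** A nonconstant divisor of [q] of least size is irreducible, and a root of it can be adjoined. *)
Lemma root_extension (E : fieldType) (q : {poly E}) : (1 < size q)%N ->
  exists (E' : fieldType) (j : {rmorphism E -> E'}) (z : E'), root (map_poly j q) z.
Proof.
move=> sq; have ex : exists n, `[< exists p : {poly E}, [/\ (1 < size p)%N, p %| q & size p = n] >].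
  by exists (size q); apply/asboolP; exists q.
case: (ex_minnP ex) => n /asboolP[p [sp pq pn]] min.
have p_irr : irreducible_poly p.
  split=> // s s1 sp'; rewrite -dvdp_size_eqp //.
  have p0 : p != 0 by rewrite -size_poly_gt0; lia.
  have s0 : s != 0 by apply: contraTneq sp' => ->; rewrite dvd0p.
  have lesp := dvdp_leq p0 sp'.
  rewrite eqn_leq lesp pn; apply: min; apply/asboolP; exists s; split=> //.
    by rewrite ltn_neqAle eq_sym s1 size_poly_gt0 s0.
  exact: dvdp_trans pq.
have [E' _ [z zr _]] := irredp_FAdjoin p_irr.
exists E', (in_alg E'), z; move: pq => /dvdpP[u ->].
by rewrite rmorphM rootM zr orbT.
Qed.

Definition splits (E : fieldType) (p : {poly E}) : Prop :=
  exists rs : seq E, p %= \prod_(e <- rs) ('X - e%:P).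

Lemma splits_root (E E' : fieldType) (j : {rmorphism E -> E'}) (p : {poly E}) z :
  splits p -> root (map_poly j p) z -> exists e, z = j e.
Proof.
move=> [rs]; rewrite -(eqp_map j) => /eqp_root ->; rewrite rmorph_prod /=.
elim: rs => [|e rs IH]; first by rewrite big_nil (negPf (root1 _)).
rewrite big_cons rootM => /orP[|//].
by rewrite rmorphB /= map_polyX map_polyC root_XsubC => /eqP ->; exists e.
Qed.

Lemma splits_of_roots (E : fieldType) (p : {poly E}) :
    (forall q, q %| p -> (1 < size q)%N -> exists e, root q e) -> p != 0 -> splits p.
Proof.
move: {2}(size p) (leqnn (size p)) => n; elim: n p => [|n IH] p sn hp p0.
  by move: p0; rewrite -size_poly_gt0; lia.
have [s1|s1] := leqP (size p) 1%N.
  by exists [::]; rewrite big_nil -size_poly_eq1 eqn_leq s1 size_poly_gt0.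
have [e /factor_theorem[q qE]] := hp p (dvdpp _) s1.
have q0 : q != 0 by apply: contraNneq p0 => q0; rewrite qE q0 mul0r.
have [||//|rs hrs] := IH q.
- by move: sn; rewrite qE size_Mmonic ?monicXsubC // size_XsubC; lia.
- by move=> s sq; apply: hp; rewrite qE dvdp_mulr.
by exists (e :: rs); rewrite big_cons qE mulrC eqp_mul2l ?polyXsubC_eq0.
Qed.

Section Conjugates.
Variables (F L E : fieldType) (iota : {rmorphism F -> L}) (kappa : {rmorphism F -> E}).
Variables (theta : L) (mu : {poly F}).
Hypothesis ext : simple_extension iota theta mu.
Hypothesis char0 : [pchar F] =i pred0.
Let d := (size mu).-1.
Let muP := ext.1.

(** A root [z] of a nonconstant divisor, taken in an extension [E'] of [E], gives an embedding of
    [L] into [E']. It maps the generators to roots of polynomials split over [E], hence into [E]; so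
    the image of [theta], which is [z], lies in [E] too. *)
Lemma simple_extension_splits (ys : seq L) : generates iota ys ->
    (forall y, y \in ys -> exists G, root (map_poly iota G) y /\ splits (map_poly kappa G)) ->
  splits (map_poly kappa mu).
Proof.
move=> gen hG; apply: splits_of_roots; last first.
  by rewrite map_poly_eq0 (monic_neq0 muP.1).
move=> q qmu /root_extension[E' [j [z zq]]].
have zmu : root (map_poly (j \o kappa) mu) z.
  rewrite map_poly_comp; case/dvdpP: qmu => u ->.
  by rewrite rmorphM rootM zq orbT.
have [s [sc st]] := simple_extension_embedding ext zmu.
have : exists e, s theta = j e.
  apply: (gen (fun x => exists e, s x = j e)).
  - have [h1 hB hD] := rmorph_range_subfield j; split; first by rewrite rmorph1.
      by move=> x y; rewrite rmorphB; apply: hB.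
    by move=> x y; rewrite fmorph_div; apply: hD.
  - by move=> c; exists (kappa c); rewrite sc.
  move=> y /hG[G [Gy sG]]; apply: (splits_root sG).
  have : root (map_poly s (map_poly iota G)) (s y).
    by rewrite rootE horner_map (eqP Gy) rmorph0.
  by rewrite -!map_poly_comp (eq_map_poly sc).
by rewrite st => -[e ze]; exists e; rewrite ze fmorph_root in zq.
Qed.

Lemma simple_extension_conjugates : splits (map_poly kappa mu) ->
  exists sigma : 'I_d -> {rmorphism L -> E},
    [/\ forall i c, sigma i (iota c) = kappa c, injective (fun i => sigma i theta)
      & forall s : {rmorphism L -> E}, (forall c, s (iota c) = kappa c) ->
          exists i, s =1 sigma i].
Proof.
move=> [rs hrs]; have mon : map_poly kappa mu \is monic by rewrite monic_map // muP.1.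
have {}hrs : map_poly kappa mu = \prod_(e <- rs) ('X - e%:P).
  by apply/eqP; rewrite -eqp_monic ?monic_prod_XsubC.
have urs : uniq rs.
  by rewrite -separable_prod_XsubC -hrs separable_map; apply: minimal_poly_separable muP _.
have szrs : size rs = d.
  by rewrite /d -(size_map_poly kappa) hrs size_prod_XsubC.
have rootrs e : root (map_poly kappa mu) e = (e \in rs) by rewrite hrs root_prod_XsubC.
have ex (i : 'I_d) : {s : {rmorphism L -> E} | (forall c, s (iota c) = kappa c) /\
    s theta = nth 0 rs i}.
  by apply/cid/(simple_extension_embedding ext); rewrite rootrs mem_nth // szrs.
exists (fun i => sval (ex i)); split.
- by move=> i c; case: (ex i) => s /= [].
- move=> i j; case: (ex i) => s /= [_ ->]; case: (ex j) => s' /= [_ ->] /eqP.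
  by rewrite nth_uniq ?szrs // => /eqP/val_inj.
move=> s sc; have : s theta \in rs.
  rewrite -rootrs -(eq_map_poly sc) map_poly_comp rootE horner_map.
  by rewrite (eqP (minimal_poly_root muP)) rmorph0.
move=> sr; have ilt : (index (s theta) rs < d)%N by rewrite -szrs index_mem.
exists (Ordinal ilt); case: (ex _) => s' /= [sc' st'].
by apply: (simple_extension_eq ext) => [c|]; rewrite ?sc ?sc' // st' nth_index.
Qed.

(* The matrix of multiplication by z on the powers of theta has the conjugates
   of z as eigenvalues, with the rows of a Vandermonde matrix as eigenvectors. *)
Lemma conjugates_char_poly (sigma : 'I_d -> {rmorphism L -> E}) z :
    (forall i c, sigma i (iota c) = kappa c) -> injective (fun i => sigma i theta) ->
  exists P : {poly F}, [/\ P \is monic, root (map_poly iota P) z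
    & map_poly kappa P = \prod_i ('X - (sigma i z)%:P)].
Proof.
move=> sc sinj; have [p zE] := ext.2 z; have mu0 := monic_neq0 muP.1.
have smu : size mu = d.+1 by rewrite prednK // size_poly_gt0.
pose A : 'M[F]_d := \matrix_(i, j) ((p * 'X^j) %% mu)`_i.
have eigen (M : fieldType) (f : {rmorphism F -> M}) (t : M) : root (map_poly f mu) t ->
    (\row_j t ^+ j) *m map_mx f A = (map_poly f p).[t] *: (\row_j t ^+ j).
  move=> rt; apply/rowP => j; rewrite !mxE.
  have -> : (map_poly f p).[t] * t ^+ j = (map_poly f ((p * 'X^j) %% mu)).[t].
    have := congr1 (fun q => (map_poly f q).[t]) (divp_eq (p * 'X^j) mu).
    rewrite rmorphD !rmorphM /= map_polyXn !hornerE (eqP rt) mulr0 add0r.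
    by [].
  rewrite (@horner_coef_wide _ d) ?size_map_poly; last first.
    by rewrite -ltnS -smu ltn_modp.
  by apply: eq_bigr => i _; rewrite !mxE coef_map mulrC.
exists (char_poly A); split; first exact: char_poly_monic.
  rewrite map_char_poly -eigenvalue_root_char; apply/eigenvalueP.
  exists (\row_j theta ^+ j); first by rewrite eigen ?(minimal_poly_root muP) // -zE.
  apply/eqP => /rowP h; have d0 : (0 < d)%N by have := minimal_poly_size muP; rewrite /d; lia.
  by have := h (Ordinal d0); rewrite !mxE expr0 => /eqP; rewrite oner_eq0.
rewrite map_char_poly.
pose V : 'M[E]_d := \matrix_(i, j) sigma i theta ^+ j.
pose D : 'rV[E]_d := \row_i sigma i z.
have VA : V *m map_mx kappa A = diag_mx D *m V.
  apply/row_matrixP => i; rewrite row_mul.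
  have -> : row i V = \row_j sigma i theta ^+ j by apply/rowP => j; rewrite !mxE.
  rewrite eigen; last first.
    rewrite -(eq_map_poly (sc i)) map_poly_comp rootE horner_map.
    by rewrite (eqP (minimal_poly_root muP)) rmorph0.
  apply/rowP => j; rewrite mul_diag_mx !mxE; congr (_ * _); rewrite zE -horner_map -map_poly_comp.
  by congr (_.[_]); apply: eq_map_poly => c /=; rewrite sc.
have detV : \det V != 0.
  have -> : V = (Vandermonde d (\row_i sigma i theta))^T.
    by apply/matrixP => i j; rewrite !mxE.
  rewrite det_tr det_Vandermonde; apply/prodf_neq0 => i _; apply/prodf_neq0 => j ij.
  rewrite !mxE subr_eq0; apply: contraTneq ij => /sinj ->; by rewrite ltnn.
have detVP : \det (map_mx (@polyC E) V) != 0.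
  by rewrite det_map_mx polyC_eq0.
apply: (mulfI detVP); rewrite /char_poly -det_mulmx.
have -> : map_mx (@polyC E) V *m char_poly_mx (map_mx kappa A) =
    char_poly_mx (diag_mx D) *m map_mx (@polyC E) V.
  rewrite /char_poly_mx mulmxBr mulmxBl -scalar_mxC; congr (_ - _).
  by rewrite -!map_mxM VA.
rewrite det_mulmx mulrC; congr (_ * _); rewrite -/(char_poly _) char_poly_trig ?diag_mx_is_trig //.
by apply: eq_bigr => i _; rewrite !mxE eqxx mulr1n.
Qed.
End Conjugates.

(** * Puiseux expansions at infinity *)

Lemma cancel_factor (F : fieldType) (a u v w : F) : u != 0 ->
  (v * u) * (a * (u^-1 * w)) = a * v * w.
Proof. by move=> u0; field. Qed.

Section PuiseuxRoots.
Variables (K : closedFieldType) (f g : {poly K}) (M N : nat).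
Hypothesis char0 : [pchar K] =i pred0.
Hypotheses (f_nonconst : (1 < size f)%N) (g_nonconst : (1 < size g)%N).
Let m := (size f).-1.
Let n := (size g).-1.
Hypothesis weights : (m * N = n * M)%N.
Hypotheses (M_gt0 : (0 < M)%N) (N_gt0 : (0 < N)%N).

Local Notation E := (laurent K).
Local Notation kappa := (@series_const K).
Local Notation t := (series_t K).

Definition infinity_poly : {poly E} :=
  map_poly kappa g - ((map_poly kappa f).[t ^- N])%:P.

(* infinity_poly at t^-M V, cleared of its pole by the factor t^(nM). *)
Let H : {poly pseries K} :=
  \poly_(j < n.+1) poly_pseries (g`_j *: 'X^(M * (n - j)))
  - (poly_pseries (\sum_(j < m.+1) f`_j *: 'X^(N * (m - j))))%:P.

Let n_gt0 : (0 < n)%N. Proof. by rewrite /n -subn1 subn_gt0. Qed.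
Let size_g : size g = n.+1. Proof. by rewrite prednK // ltnW. Qed.
Let size_f : size f = m.+1. Proof. by rewrite prednK // ltnW. Qed.
Let gn : g`_n != 0.
Proof. by rewrite -lead_coefE lead_coef_eq0 -size_poly_gt0 size_g. Qed.
Let fm : f`_m != 0.
Proof. by rewrite -lead_coefE lead_coef_eq0 -size_poly_gt0 size_f. Qed.
Let t0 : t != 0. Proof. by have [] := series_t_ord K. Qed.

Lemma tofrac_monomial (c : K) i : tofrac (poly_pseries (c *: 'X^i)) = kappa c * t ^+ i.
Proof. by rewrite -mul_polyC !rmorphM !rmorphXn. Qed.

(** By [m * N = n * M] the leading terms of [g(Y)] and [f(X)] have the same pole order, so a single
    power of [t] clears both. *)
Lemma infinity_polyE V : t ^+ (n * M) * infinity_poly.[t ^- M * tofrac V] = tofrac H.[V].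
Proof.
rewrite /infinity_poly /H !(hornerD, hornerN, hornerC) horner_poly tofracB mulrBr.
congr (_ - _).
  rewrite (@horner_coef_wide _ n.+1) ?size_map_poly ?size_g //.
  rewrite mulr_sumr rmorph_sum; apply: eq_bigr => -[j /= jn] _.
  rewrite coef_poly jn tofracM tofracXn tofrac_monomial exprMn exprVn -exprM.
  have -> : (n * M = M * (n - j) + M * j)%N by rewrite -mulnDr subnK // mulnC.
  by rewrite exprD; apply: cancel_factor; rewrite expf_neq0.
rewrite (@horner_coef_wide _ m.+1) ?size_map_poly ?size_f //.
rewrite mulr_sumr !rmorph_sum; apply: eq_bigr => -[j /= jm] _.
rewrite tofrac_monomial exprVn -exprM -weights.
have -> : (m * N = N * (m - j) + N * j)%N by rewrite -mulnDr subnK // mulnC.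
rewrite exprD; have := @cancel_factor E (kappa f`_j) _ (t ^+ (N * (m - j))) 1 (expf_neq0 (N * j) t0).
by rewrite !mulr1 coef_map.
Qed.

Lemma constant_term_H : map_poly (@constant_term K) H = g`_n *: 'X^n - (f`_m)%:P.
Proof.
rewrite /H rmorphB /= map_polyC; congr (_ - _%:P).
  apply/polyP => i; rewrite coef_map coef_poly coefZ coefXn.
  have [->|ni] := eqVneq i n; rewrite ?mulr0n ?mulr0.
    by rewrite ltnSn subnn muln0 expr0 /constant_term /= coefZ coef1.
  case: ifP => ilt; last exact: rmorph0.
  rewrite /constant_term /= coefZ coefXn [0%N == _]eq_sym -[_ == 0%N]negbK -lt0n.
  by rewrite muln_gt0 M_gt0 subn_gt0 ltn_neqAle ni -ltnS ilt mulr0.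
rewrite /constant_term /= coef_sum big_ord_recr big1 /=; last first.
  move=> [j jm] _ /=; rewrite coefZ coefXn [0%N == _]eq_sym -[_ == 0%N]negbK -lt0n.
  by rewrite muln_gt0 N_gt0 subn_gt0 jm mulr0.
by rewrite subnn muln0 expr0 coefZ coef1 mulr1 add0r.
Qed.

(** Distinctness uses characteristic zero: a double root would be a root of [n X^(n-1)], hence 0,
    whereas [f_m] is nonzero. *)
Lemma leading_constants : exists cs : seq K,
  [/\ uniq cs, size cs = n & forall c, c \in cs -> c != 0 /\ g`_n * c ^+ n = f`_m].
Proof.
pose p : {poly K} := 'X^n - (f`_m / g`_n)%:P.
have sp : size p = n.+1 by rewrite size_XnsubC.
have mp : p \is monic by apply: monicXnsubC.
have [cs hcs] := closed_field_poly_normal p; rewrite (monicP mp) scale1r in hcs.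
have csP c : c \in cs -> c != 0 /\ g`_n * c ^+ n = f`_m.
  rewrite -root_prod_XsubC -hcs rootE !hornerE subr_eq0 => /eqP e; split.
    apply: contraNneq fm => c0; move/eqP: e; rewrite c0 expr0n (gtn_eqF n_gt0) /=.
    by rewrite eq_sym mulf_eq0 invr_eq0 (negPf gn) orbF.
  by rewrite e mulrC divfK.
exists cs; split=> //; last by have := congr1 (@size K) (congr1 val hcs);
  rewrite sp size_prod_XsubC => -[].
rewrite -separable_prod_XsubC -hcs unlock; apply/coprimepP => q qp qd.
rewrite -size_poly_eq1 eqn_leq size_poly_gt0; apply/andP; split; last first.
  by apply: contraTneq qp => ->; rewrite dvd0p -size_poly_eq0 sp.
rewrite leqNgt; apply/negP => sq.
have /closed_rootP[c rc] : size q != 1%N by rewrite gtn_eqF.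
have rq s : q %| s -> root s c by case/dvdpP => u ->; rewrite rootM rc orbT.
have [c0 _] : c != 0 /\ g`_n * c ^+ n = f`_m.
  by apply: csP; rewrite -root_prod_XsubC -hcs; apply: rq.
have := rq _ qd; rewrite derivB derivC subr0 derivXn rootE hornerMn hornerXn.
by rewrite -mulr_natr mulf_eq0 (negPf (expf_neq0 _ c0)) (pcharf0P _).1 // gtn_eqF.
Qed.

(** Hensel's lemma lifts each leading constant to a root, and the [n] roots so obtained exhaust the
    degree. The last clause, that a root is known from its leading term, is what later identifies
    embeddings. *)
Lemma infinity_roots : exists ys : seq E,
  [/\ infinity_poly = kappa g`_n *: \prod_(y <- ys) ('X - y%:P), uniq ys,
      forall y, y \in ys -> y != 0 /\ laurent_ord y = - M%:Z
    & forall y z, y \in ys -> z \in ys -> vge (@laurent_ord K) (1 - M%:Z) (y - z) -> y = z].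
Proof.
have [cs [ucs scs hcs]] := leading_constants.
(* The membership condition sits under the existential so that one choice function is defined on all
   of [K]. *)
have ex c : exists V : pseries K, c \in cs -> H.[V] = 0 /\ constant_term V = c.
  have [ccs|_] := boolP (c \in cs); last by exists 0.
  have [c0 ec] := hcs c ccs.
  have [||V hV] := @hensel K H c; last by exists V.
    by rewrite -horner_map /= coefC eqxx constant_term_H !hornerE ec subrr.
  rewrite -horner_map /= coefC eqxx -deriv_map constant_term_H derivB derivC subr0 derivZ derivXn.
  rewrite !hornerE /= hornerMn hornerXn -mulr_natr !mulf_neq0 ?expf_neq0 //.
  by rewrite (pcharf0P _).1 // -lt0n.
pose V c := sval (cid (ex c)).
have VP c : c \in cs -> H.[V c] = 0 /\ constant_term (V c) = c.
  by rewrite /V; case: cid.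
pose y c : E := t ^- M * tofrac (V c).
have oP := laurent_ord_valuation K.
have tM : laurent_ord (t ^- M) = - M%:Z.
  have [_ ot] := series_t_ord K.
  by rewrite val_inv ?expf_neq0 // val_exp // ot natz.
have unit_ord (a : pseries K) : constant_term a != 0 ->
    t ^- M * tofrac a != 0 /\ laurent_ord (t ^- M * tofrac a) = - M%:Z.
  move=> ha; have [a0 oa] := pord_unique (@ord_ge0 _ a) ha.
  have aF : tofrac a != 0 by rewrite tofrac_eq0.
  rewrite mulf_neq0 ?invr_eq0 ?expf_neq0 //; split=> //.
  by rewrite val_mul ?invr_eq0 ?expf_neq0 // tM laurent_ord_tofrac // oa addr0.
(* Different constant terms leave [V c - V d] invertible, so the difference of the roots has order
   exactly [-M]. *)
have y_far c d : c \in cs -> d \in cs -> vge (@laurent_ord K) (1 - M%:Z) (y c - y d) -> c = d.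
  move=> ccs dcs; apply: contraTeq => cd; rewrite /y -mulrBr -tofracB.
  have [|z0 oz] := unit_ord (V c - V d).
    by rewrite rmorphB /= (VP c ccs).2 (VP d dcs).2 subr_eq0.
  by rewrite vgeE // oz; lia.
have y_inj : {in cs &, injective y}.
  by move=> c d ccs dcs e; apply: y_far; rewrite // e subrr vge0.
have root_y c : c \in cs -> root infinity_poly (y c).
  move=> ccs; have := infinity_polyE (V c); rewrite (VP c ccs).1 tofrac0 => /eqP.
  by rewrite mulf_eq0 (negPf (expf_neq0 _ t0)).
have sz : size infinity_poly = n.+1.
  rewrite /infinity_poly size_polyDl size_map_poly size_g //.
  by rewrite size_polyN (leq_ltn_trans (size_polyC_leq1 _)).
exists (map y cs); split.
- rewrite {1}(@all_roots_prod_XsubC _ infinity_poly (map y cs)).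
  + congr (_ *: _); rewrite lead_coefE sz /infinity_poly coefB coef_map coefC.
    by rewrite gtn_eqF // subr0.
  + by rewrite sz size_map scs.
  + by apply/allP => _ /mapP[c ccs ->]; apply: root_y.
  + by rewrite uniq_rootsE map_inj_in_uniq.
- by rewrite map_inj_in_uniq.
- move=> _ /mapP[c ccs ->]; apply: unit_ord; rewrite (VP c ccs).2.
  by have [] := hcs c ccs.
move=> _ _ /mapP[c ccs ->] /mapP[d dcs ->] h.
by rewrite (y_far c d).
Qed.

Lemma infinity_poly_splits : splits infinity_poly.
Proof.
have [ys [-> _ _ _]] := infinity_roots; exists ys.
by rewrite eqp_scale // fmorph_eq0.
Qed.

Lemma infinity_root_ord y : root infinity_poly y -> y != 0 /\ laurent_ord y = - M%:Z.
Proof.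
have [ys [-> _ h _]] := infinity_roots.
by rewrite rootZ ?fmorph_eq0 // root_prod_XsubC => /h.
Qed.

Lemma infinity_root_eq y z : root infinity_poly y -> root infinity_poly z ->
  vge (@laurent_ord K) (1 - M%:Z) (y - z) -> y = z.
Proof.
have [ys [-> _ _ h]] := infinity_roots.
by rewrite !rootZ ?fmorph_eq0 // !root_prod_XsubC; apply: h.
Qed.
End PuiseuxRoots.

(** * Places at infinity *)

Lemma div_neq0 (F : fieldType) (x y : F) : x != 0 -> y != 0 -> x / y != 0.
Proof. by move=> x0 y0; rewrite mulf_neq0 ?invr_eq0. Qed.

Section Residues.
Variable K : fieldType.
Local Notation E := (laurent K).
Local Notation ord := (@laurent_ord K).
Local Notation kappa := (@series_const K).
Let oP := laurent_ord_valuation K.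

Definition residue (x : E) (c : K) : Prop := vge ord 1 (x - kappa c).

Lemma residue_exists x : x != 0 -> ord x = 0 -> exists2 c, c != 0 & residue x c.
Proof. exact: laurent_residue. Qed.

Lemma vge_const c : vge ord 0 (kappa c).
Proof.
have [->|c0] := eqVneq c 0; first by rewrite rmorph0 vge0.
by rewrite vgeE ?fmorph_eq0 // laurent_ord_const.
Qed.

Lemma residue_vge x c : residue x c -> vge ord 0 x.
Proof.
move=> xc; rewrite -(subrK (kappa c) x); apply: vgeD (vge_const c) => //.
exact: vgeW xc.
Qed.

Lemma residue_unique x c d : residue x c -> residue x d -> c = d.
Proof.
move=> xc xd; apply/eqP; apply: contraT => cd.
have := vgeB oP xd xc; rewrite opprB addrC addrA subrK -rmorphB.
by rewrite vgeE ?fmorph_eq0 ?subr_eq0 // laurent_ord_const ?subr_eq0.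
Qed.

Lemma residue_sub x y c : residue x c -> residue y c -> vge ord 1 (x - y).
Proof. by move=> xc yc; have := vgeB oP xc yc; rewrite opprB addrA subrK. Qed.

Lemma residueM x y c d : residue x c -> residue y d -> residue (x * y) (c * d).
Proof.
move=> xc yd; rewrite /residue rmorphM.
have -> : x * y - kappa c * kappa d = (x - kappa c) * y + kappa c * (y - kappa d).
  by rewrite mulrBl mulrBr addrA subrK.
apply: vgeD => //; first by have := vgeM oP xc (residue_vge yd); rewrite addr0.
by have := vgeM oP (vge_const c) yd; rewrite add0r.
Qed.

Lemma residueX x c n : residue x c -> residue (x ^+ n) (c ^+ n).
Proof.
move=> xc; elim: n => [|n IH]; last by rewrite !exprS; apply: residueM.
by rewrite /residue !expr0 rmorph1 subrr vge0.
Qed.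
End Residues.

(** The boundary described by [X] alone, for an abstract function field; [boundary_at_infinity]
    makes the link. *)
Definition place_at_infinity (K L : fieldType) (cst : {rmorphism K -> L}) (X : L)
    (v : L -> int) : Prop :=
  [/\ v 0 = 0, normalized v, forall c, c != 0 -> v (cst c) = 0, valuation v & v X < 0].

Section PlacesAtInfinity.
Variables (K : closedFieldType) (f g : {poly K}) (M N e r : nat).
Hypothesis char0 : [pchar K] =i pred0.
Hypotheses (f_nonconst : (1 < size f)%N) (g_nonconst : (1 < size g)%N).
Hypotheses (mE : (size f).-1 = (M * e)%N) (nE : (size g).-1 = (N * e)%N).
Hypothesis coMN : coprime M N.
Hypothesis r_pos : (0 < r)%N.

Local Notation F := {fraction {poly K}}.
Local Notation E := (laurent K).
Local Notation ord := (@laurent_ord K).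
Local Notation kappa := (@series_const K).
Local Notation t := (series_t K).

Variables (L : fieldType) (cst : {rmorphism K -> L}) (X : L) (Y : 'I_r -> L).
Variable iota : {rmorphism F -> L}.
Hypothesis iotaE : forall p, iota (tofrac p) = (map_poly cst p).[X].
Hypothesis curve : forall i, (map_poly cst f).[X] = (map_poly cst g).[Y i].
Hypothesis gen : generates iota [seq Y i | i <- enum 'I_r].
Variables (theta : L) (mu : {poly F}).
Hypothesis ext : simple_extension iota theta mu.
Let d := (size mu).-1.

Let M_gt0 : (0 < M)%N.
Proof. by move: f_nonconst; rewrite -ltn_predRL mE; case: M. Qed.
Let N_gt0 : (0 < N)%N.
Proof. by move: g_nonconst; rewrite -ltn_predRL nE; case: N. Qed.
Let weights : ((size f).-1 * N = (size g).-1 * M)%N.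
Proof. by rewrite mE nE -mulnA mulnC [(e * N)%N]mulnC. Qed.
Let oP := laurent_ord_valuation K.
Let t0 : t != 0. Proof. by have [] := series_t_ord K. Qed.
Let ot : ord t = 1. Proof. by have [] := series_t_ord K. Qed.

Lemma pole_horner (L' : fieldType) (c : {rmorphism K -> L'}) (v : L' -> int) x p :
    valuation v -> (forall a, a != 0 -> v (c a) = 0) -> v x < 0 -> x != 0 -> p != 0 ->
  (map_poly c p).[x] != 0 /\ v (map_poly c p).[x] = v x *+ (size p).-1.
Proof.
move=> vP vc vx x0 p0.
rewrite -(size_map_poly c p); apply: val_horner_pole => //.
- by rewrite map_poly_eq0.
- move=> i; rewrite coef_map /=; have [->|pi] := eqVneq p`_i 0.
    by rewrite rmorph0 vge0.
  by rewrite vgeE ?fmorph_eq0 // vc.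
by rewrite lead_coef_map vc // lead_coef_eq0.
Qed.

Let ordX : ord (t ^- N) = - N%:Z.
Proof. by rewrite val_inv ?expf_neq0 // val_exp // ot natz. Qed.

Lemma embedding_at_infinity :
  exists lambda : {rmorphism F -> E}, forall p, lambda (tofrac p) = (map_poly kappa p).[t ^- N].
Proof.
have inj : injective (horner_eval (t ^- N) \o map_poly kappa).
  move=> p q; rewrite /= /horner_eval => pq; apply/eqP; rewrite -subr_eq0.
  apply: contraT => pq0.
  have [] := @pole_horner _ kappa ord (t ^- N) _ oP (@laurent_ord_const K) _ _ pq0.
  - by rewrite ordX oppr_lt0 ltz_nat.
  - by rewrite invr_eq0 expf_neq0.
  by rewrite rmorphB hornerD hornerN pq subrr eqxx.
by have [lambda lE] := fraction_lift inj; exists lambda.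
Qed.

Variable lambda : {rmorphism F -> E}.
Hypothesis lambdaE : forall p, lambda (tofrac p) = (map_poly kappa p).[t ^- N].

Lemma iota_X : iota (tofrac 'X) = X.
Proof. by rewrite iotaE map_polyX hornerX. Qed.

Lemma iota_const c : iota (tofrac c%:P) = cst c.
Proof. by rewrite iotaE map_polyC hornerC. Qed.

Section Embedding.
Variable sigma : {rmorphism L -> E}.
Hypothesis sigma_lambda : forall c, sigma (iota c) = lambda c.

Lemma sigma_X : sigma X = t ^- N.
Proof. by rewrite -iota_X sigma_lambda lambdaE map_polyX hornerX. Qed.

Lemma sigma_const c : sigma (cst c) = kappa c.
Proof. by rewrite -iota_const sigma_lambda lambdaE map_polyC hornerC. Qed.

Lemma sigma_Y i : root (infinity_poly f g N) (sigma (Y i)).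
Proof.
rewrite rootE /infinity_poly !(hornerD, hornerN, hornerC) -sigma_X.
have mapE p : map_poly kappa p = map_poly sigma (map_poly cst p).
  by rewrite -map_poly_comp; apply: eq_map_poly => c /=; rewrite sigma_const.
by rewrite !mapE !horner_map (curve i) subrr.
Qed.

(** The value at 0 follows the convention of [is_place], so that equal places are equal
    functions. *)
Definition pullback_ord (x : L) : int := if x == 0 then 0 else ord (sigma x).

Lemma pullback_ordE x : x != 0 -> pullback_ord x = ord (sigma x).
Proof. by rewrite /pullback_ord => /negPf->. Qed.

Lemma vge_pullback n x : vge pullback_ord n x = vge ord n (sigma x).
Proof. by rewrite /vge /pullback_ord fmorph_eq0; case: eqP. Qed.

Lemma X_neq0 : X != 0.
Proof. by rewrite -(fmorph_eq0 sigma) sigma_X invr_eq0 expf_neq0. Qed.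

Lemma Y_ord i : Y i != 0 /\ pullback_ord (Y i) = - M%:Z.
Proof.
have [y0 oy] := infinity_root_ord char0 f_nonconst g_nonconst weights M_gt0 N_gt0 (sigma_Y i).
have Y0 : Y i != 0 by rewrite -(fmorph_eq0 sigma).
by rewrite pullback_ordE.
Qed.

Lemma X_ord : pullback_ord X = - N%:Z.
Proof. by rewrite pullback_ordE ?X_neq0 // sigma_X. Qed.

Lemma pullback_valuation : valuation pullback_ord.
Proof.
split=> x y x0 y0; first by rewrite !pullback_ordE ?mulf_neq0 // rmorphM oP.1 ?fmorph_eq0.
move=> xy0; rewrite !pullback_ordE // rmorphD; apply: oP.2; rewrite -?rmorphD ?fmorph_eq0 //.
Qed.

Lemma pullback_uniformizer : exists2 u, u != 0 & pullback_ord u = 1.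
Proof.
(* Bezout: [a * N = b * M + 1], so [Y^b / X^a] has order [a N - b M = 1]. *)
have [a b ab _] := egcdnP M N_gt0; rewrite gcdnC (eqP coMN) in ab.
have [y0 oy] := Y_ord (Ordinal r_pos); have wP := pullback_valuation.
exists (Y (Ordinal r_pos) ^+ b / X ^+ a).
  by rewrite mulf_neq0 ?invr_eq0 ?expf_neq0 ?X_neq0.
rewrite val_div ?expf_neq0 ?X_neq0 // !val_exp ?X_neq0 // oy X_ord !mulNrn opprK.
have natE (p q : nat) : p%:Z *+ q = (p * q)%N by rewrite -mulr_natr natz.
by rewrite !natE [(N * a)%N]mulnC ab [(M * b)%N]mulnC PoszD addKr.
Qed.

Lemma pullback_place : place_at_infinity cst X pullback_ord.
Proof.
split; first by rewrite /pullback_ord eqxx.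
- exact: pullback_uniformizer.
- by move=> c c0; rewrite pullback_ordE ?fmorph_eq0 // sigma_const laurent_ord_const.
- exact: pullback_valuation.
by rewrite X_ord oppr_lt0 ltz_nat.
Qed.
End Embedding.

(** On a quotient [a / b] of polynomials in [X] both orders are positive multiples of
    [deg b - deg a], so regularity is decided by degrees alone. *)
Lemma iota_vge v c : place_at_infinity cst X v -> vge ord 0 (lambda c) -> vge v 0 (iota c).
Proof.
move=> [_ _ vc vP vX].
have X0 : X != 0.
  apply/eqP => X0; have : iota (tofrac 'X) = 0 by rewrite iota_X.
  by move/eqP; rewrite fmorph_eq0 tofrac_eq0 polyX_eq0.
have [a [b [b0 ->]]] := fraction_numden c.
have [->|a0] := eqVneq a 0; first by rewrite tofrac0 mul0r !rmorph0 !vge0.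
rewrite !fmorph_div !iotaE !lambdaE.
have tN0 : t ^- N != 0 by rewrite invr_eq0 expf_neq0.
have tN : ord (t ^- N) < 0 by rewrite ordX oppr_lt0 ltz_nat.
have [la0 ola] := pole_horner oP (@laurent_ord_const K) tN tN0 a0.
have [lb0 olb] := pole_horner oP (@laurent_ord_const K) tN tN0 b0.
have [ia0 oia] := pole_horner vP vc vX X0 a0.
have [ib0 oib] := pole_horner vP vc vX X0 b0.
rewrite (vgeE _ _ (div_neq0 la0 lb0)) (vgeE _ _ (div_neq0 ia0 ib0)).
by rewrite !val_div // ola olb oia oib !subr_ge0 !ler_nMn2l.
Qed.

Lemma vge_coef_prod (I : Type) (s : seq I) (a : I -> E) :
    (forall i, vge ord 0 (a i)) ->
  forall j, vge ord 0 (\prod_(i <- s) ('X - (a i)%:P))`_j.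
Proof.
move=> ha; elim: s => [|i s IH] j.
  by rewrite big_nil coef1; case: eqP => _; rewrite ?vge0 // vge1.
rewrite big_cons mulrBl coefB coefXM coefCM; apply: vgeB => //.
  by case: eqP => _; rewrite ?vge0.
exact: vgeM0.
Qed.

Lemma place_is_pullback (sigma : 'I_d -> {rmorphism L -> E}) v :
    (forall i c, sigma i (iota c) = lambda c) -> injective (fun i => sigma i theta) ->
  place_at_infinity cst X v -> exists i, v = pullback_ord (sigma i).
Proof.
move=> sl sinj vI; have [v0 nv vc vP vX] := vI; apply: contrapT => nex.
have [|z [z0 vz wz]] := @weak_approximation _ _ v (fun i => pullback_ord (sigma i))
    (enum 'I_d) vP nv.
  move=> i _; have [_ nw _ wP _] := pullback_place (sl i); split=> // h.
  apply: nex; exists i; apply/funext => x.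
  by have [->|/h//] := eqVneq x 0; rewrite v0 /pullback_ord eqxx.
have [P [Pm Pz PE]] := conjugates_char_poly ext z sl sinj.
(* The coefficients of [P] are symmetric functions of elements of positive order, hence regular
   after [lambda]; [iota_vge] transfers this to [v]. *)
have : vge v 0 z.
  apply: (vge_integral vP (monic_map iota Pm) _ Pz) => j; rewrite coef_map.
  apply: iota_vge => //; rewrite -coef_map PE; apply: vge_coef_prod => i.
  rewrite -vge_pullback vgeE //; apply: ltW; apply: wz; exact: mem_enum.
by rewrite vgeE // leNgt vz.
Qed.

(** Both embeddings send [Y i] to roots of [infinity_poly], and such roots are separated modulo
    [t^(1-M)]. *)
Lemma embedding_eq (s1 s2 : {rmorphism L -> E}) :
    (forall c, s1 (iota c) = lambda c) -> (forall c, s2 (iota c) = lambda c) ->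
    (forall i, vge ord (1 - M%:Z) (s1 (Y i) - s2 (Y i))) -> s1 =1 s2.
Proof.
move=> h1 h2 hY; apply: (gen (S := fun x => s1 x = s2 x)).
- split; first by rewrite !rmorph1.
    by move=> x y ex ey; rewrite !rmorphB ex ey.
  by move=> x y ex ey; rewrite !fmorph_div ex ey.
- by move=> c; rewrite h1 h2.
move=> _ /mapP[i _ ->].
exact: (infinity_root_eq char0 f_nonconst g_nonconst weights M_gt0 N_gt0 (sigma_Y h1 i)
   (sigma_Y h2 i) (hY i)).
Qed.

Lemma dilation_residue (A : {rmorphism E -> E}) x c :
    (forall a, A (kappa a) = kappa a) -> (forall y, y != 0 -> ord (A y) = ord y) ->
  residue x c -> residue (A x) c.
Proof.
move=> Ac Ao; rewrite /residue -{2}(Ac c) -rmorphB.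
by have [->|x0] := eqVneq (x - kappa c) 0; rewrite ?rmorph0 ?vge0 // !vgeE ?fmorph_eq0 ?Ao.
Qed.

Lemma roots_of_unity : exists us : seq K,
  [/\ uniq us, size us = N & forall c, (c \in us) = (c ^+ N == 1)].
Proof.
have [cs hcs] := closed_field_poly_normal ('X^N - 1 : {poly K}).
rewrite (monicP (monicXnsubC _ N_gt0)) scale1r in hcs.
exists cs; split.
- rewrite -separable_prod_XsubC -hcs separable_Xn_sub_1 //.
  by rewrite (pcharf0P _).1 // -lt0n.
- have := congr1 (fun p : {poly K} => size p) hcs.
  by rewrite size_XnsubC // size_prod_XsubC => -[].
by move=> c; rewrite -root_prod_XsubC -hcs rootE !hornerE subr_eq0.
Qed.

(** The fibre is put in bijection with the [N]-th roots of unity. The invariant is the residue of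
    [s u / t], the leading coefficient of a uniformizer [u] under the embedding [s]. *)
Lemma card_fibre (sigma : 'I_d -> {rmorphism L -> E}) i :
    (forall i c, sigma i (iota c) = lambda c) ->
    (forall s : {rmorphism L -> E}, (forall c, s (iota c) = lambda c) ->
       exists j, s =1 sigma j) ->
    injective (fun i => sigma i theta) ->
  #|[pred j | pullback_ord (sigma j) == pullback_ord (sigma i)]| = N.
Proof.
move=> sl sall sinj; have [us [uus sus usP]] := roots_of_unity.
have [u u0 ou] := pullback_uniformizer (sl i).
have us0 c : c \in us -> c != 0.
  rewrite usP; apply: contraTneq => ->; rewrite expr0n gtn_eqF //= eq_sym oner_eq0 //.
have lead (s : {rmorphism L -> E}) : (forall c, s (iota c) = lambda c) -> pullback_ord s = pullback_ord (sigma i) ->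
    exists2 a, a != 0 & residue (s u / t) a.
  move=> _ ws; apply: residue_exists; first by rewrite mulf_neq0 ?invr_eq0 ?fmorph_eq0.
  by rewrite val_div ?fmorph_eq0 // ot -pullback_ordE // ws ou.
have [a a0 ra] := lead _ (sl i) erefl.
have twist c : c \in us -> exists j, exists A : {rmorphism E -> E},
    [/\ forall x, sigma j x = A (sigma i x), forall a, A (kappa a) = kappa a,
        A t = kappa c * t & forall y, y != 0 -> ord (A y) = ord y].
  move=> cus; have [A [Ac At Ao]] := laurent_dilation (us0 c cus).
  have Al : forall z, A (lambda z) = lambda z.
    apply: (@rmorph_fraction_eq _ _ (A \o lambda) lambda) => p.
    rewrite /= lambdaE -horner_map -map_poly_comp; congr (_.[_]); last first.
      rewrite fmorphV rmorphXn At exprMn -rmorphXn; move: cus; rewrite usP => /eqP->.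
      by rewrite rmorph1 mul1r.
    by apply: eq_map_poly => b /=; rewrite Ac.
  have [|j jE] := sall (A \o sigma i); first by move=> z; rewrite /= sl Al.
  by exists j, A; split=> // x; rewrite -jE.
(* Since [A t = c t], the quotient [sigma j u / t] is [c] times [A (sigma i u / t)], and [A]
   preserves residues. *)
have twist_lead c j (A : {rmorphism E -> E}) : (forall x, sigma j x = A (sigma i x)) ->
    (forall a, A (kappa a) = kappa a) -> A t = kappa c * t -> c != 0 ->
    (forall y, y != 0 -> ord (A y) = ord y) -> residue (sigma j u / t) (c * a).
  move=> jE Ac At c0 Ao; have := dilation_residue Ac Ao ra.
  rewrite fmorph_div At -jE => h.
  have rc : residue (kappa c) c by rewrite /residue subrr vge0.
  have := residueM rc h; congr residue.
  by rewrite invfM mulrCA mulrA mulrA mulfK ?fmorph_eq0 // mulrC.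
have [tw twP] : exists tw : K -> 'I_d, forall c, c \in us ->
    exists A : {rmorphism E -> E}, [/\ forall x, sigma (tw c) x = A (sigma i x),
      forall a, A (kappa a) = kappa a, A t = kappa c * t
      & forall y, y != 0 -> ord (A y) = ord y].
  have ex c : exists j, c \in us -> exists A : {rmorphism E -> E},
    [/\ forall x, sigma j x = A (sigma i x), forall a, A (kappa a) = kappa a,
      A t = kappa c * t & forall y, y != 0 -> ord (A y) = ord y].
    have [cus|_] := boolP (c \in us); last by exists i.
    by have [j hj] := twist c cus; exists j.
  by exists (fun c => sval (cid (ex c))) => c; case: cid.
(* Freeness: different [c] give different residues [c * a], as [a] is nonzero. *)
rewrite -sus -(size_map tw) -(card_uniqP _); last first.
  rewrite map_inj_in_uniq // => b c bus cus tbc.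
  have [A [A1 A2 A3 A4]] := twP b bus; have [B [B1 B2 B3 B4]] := twP c cus.
  have rb := twist_lead b _ A A1 A2 A3 (us0 _ bus) A4.
  have := twist_lead c _ B B1 B2 B3 (us0 _ cus) B4; rewrite -tbc => rc.
  exact: mulIf a0 _ _ (residue_unique rb rc).
apply: eq_card => j; rewrite inE; apply/eqP/mapP => [wj|[c cus ->]]; last first.
  have [A [A1 _ _ A4]] := twP c cus; apply/funext => x; rewrite /pullback_ord.
  by case: eqVneq => // x0; rewrite A1 A4 // fmorph_eq0.
have [b b0 rb] := lead _ (sl j) wj.
(* sigma_i and sigma_j induce the same residues on the valuation ring of their
   common place. *)
have same z c : residue (sigma i z) c -> residue (sigma j z) c.
  rewrite /residue -{1}(sigma_const (sl i)) -(sigma_const (sl j)) -!rmorphB.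
  by rewrite -!vge_pullback wj.
(* Because [X] goes to [t^-N], the image of [X * u ^+ N] is the [N]-th power of [s u / t]; its
   residue is common to both embeddings by [same]. *)
have ab : a ^+ N = b ^+ N.
  have sE (s : {rmorphism L -> E}) : (forall c, s (iota c) = lambda c) -> s (X * u ^+ N) = (s u / t) ^+ N.
    by move=> hs; rewrite rmorphM rmorphXn (sigma_X hs) exprMn exprVn mulrC.
  apply: (@residue_unique _ (sigma j (X * u ^+ N))).
    by apply: same; rewrite sE; [apply: residueX|apply: sl].
  by rewrite sE; [apply: residueX|apply: sl].
have cus : b / a \in us by rewrite usP expr_div_n ab divff // -ab expf_neq0.
exists (b / a) => //.
have [A [A1 A2 A3 A4]] := twP _ cus.
have rt := twist_lead _ _ A A1 A2 A3 (us0 _ cus) A4; rewrite divfK // in rt.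
(* After the twist by [b / a] both embeddings give [u] the leading coefficient [b]. The residue
   [rho] of [Y l * u ^+ M] is also common, so both give [Y l] the leading coefficient
   [rho / b ^+ M]. *)
apply: sinj; apply: embedding_eq => // l; set k := tw _ in A1 rt *.
have [Yl0 oYl] := Y_ord (sl i) l; have wP := pullback_valuation (sigma i).
have [rho rho0 rrho] : exists2 rho, rho != 0 & residue (sigma i (Y l * u ^+ M)) rho.
  apply: residue_exists; first by rewrite fmorph_eq0 mulf_neq0 ?expf_neq0.
  rewrite -pullback_ordE ?mulf_neq0 ?expf_neq0 // val_mul ?expf_neq0 // val_exp //.
  by rewrite oYl ou natz addNr.
have lim (s : {rmorphism L -> E}) : (forall c, s (iota c) = lambda c) -> residue (s u / t) b ->
    residue (s (Y l * u ^+ M)) rho -> residue (s (Y l) * t ^+ M) (rho / b ^+ M).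
  move=> hs rs rr.
  have [y0 oy] := infinity_root_ord char0 f_nonconst g_nonconst weights M_gt0 N_gt0 (sigma_Y hs l).
  have [h h0 rh] : exists2 h, h != 0 & residue (s (Y l) * t ^+ M) h.
    apply: residue_exists; first by rewrite mulf_neq0 ?expf_neq0.
    by rewrite val_mul ?expf_neq0 // val_exp // ot oy natz addNr.
  have := residueM rh (residueX M rs); rewrite expr_div_n mulrACA.
  have -> : s (Y l) * s u ^+ M * (t ^+ M / t ^+ M) = s (Y l * u ^+ M).
    by rewrite divff ?expf_neq0 // mulr1 rmorphM rmorphXn.
  by move=> /(residue_unique rr) ->; rewrite mulfK // expf_neq0.
have lj := lim _ (sl j) rb (same _ _ rrho).
have lk : residue (sigma k (Y l) * t ^+ M) (rho / b ^+ M).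
  by apply: (lim _ (sl k) rt); rewrite A1; apply: dilation_residue.
have := residue_sub lj lk; rewrite -mulrBl => h.
rewrite -[sigma j _ - _](mulfK (expf_neq0 M t0)).
apply: vgeM => //; rewrite vgeE ?invr_eq0 ?expf_neq0 //.
by rewrite val_inv ?expf_neq0 // val_exp // ot natz.
Qed.
End PlacesAtInfinity.

(** * Orders at the places at infinity and their number *)

Section CountingPlaces.
Variables (K : closedFieldType) (f g : {poly K}) (M N e r : nat).
Hypothesis char0 : [pchar K] =i pred0.
Hypotheses (f_nonconst : (1 < size f)%N) (g_nonconst : (1 < size g)%N).
Hypotheses (mE : (size f).-1 = (M * e)%N) (nE : (size g).-1 = (N * e)%N).
Hypothesis coMN : coprime M N.
Hypothesis r_pos : (0 < r)%N.
Local Notation F := {fraction {poly K}}.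
Local Notation E := (laurent K).
Variables (L : fieldType) (cst : {rmorphism K -> L}) (X : L) (Y : 'I_r -> L).
Variable iota : {rmorphism F -> L}.
Hypothesis iotaE : forall p, iota (tofrac p) = (map_poly cst p).[X].
Hypothesis curve : forall i, (map_poly cst f).[X] = (map_poly cst g).[Y i].
Hypothesis gen : generates iota [seq Y i | i <- enum 'I_r].
Variables (theta : L) (mu : {poly F}).
Hypothesis ext : simple_extension iota theta mu.

Let weights : ((size f).-1 * N = (size g).-1 * M)%N.
Proof. by rewrite mE nE -mulnA mulnC [(e * N)%N]mulnC. Qed.
Let M_gt0 : (0 < M)%N.
Proof. by move: f_nonconst; rewrite -ltn_predRL mE; case: M. Qed.
Let N_gt0 : (0 < N)%N.
Proof. by move: g_nonconst; rewrite -ltn_predRL nE; case: N. Qed.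

Lemma pchar_fraction_poly : [pchar F] =i pred0.
Proof. by move=> p; rewrite (fmorph_pchar (@tofrac {poly K} \o polyC)) char0. Qed.

Lemma places_at_infinity :
  [/\ forall v, place_at_infinity cst X v ->
        v X = - N%:Z /\ forall i, v (Y i) = - M%:Z
    & exists s, (place_at_infinity cst X #= `I_s)%card /\ (size mu).-1 = (N * s)%N].
Proof.
have [lambda lE] := embedding_at_infinity g_nonconst nE.
have mapE (R' : fieldType) (c : {rmorphism K -> R'}) (h : {rmorphism F -> R'}) :
    (forall a, h (tofrac a%:P) = c a) ->
    forall p : {poly K}, map_poly h (map_poly (@tofrac {poly K} \o polyC) p) = map_poly c p.
  by move=> hc p; rewrite -map_poly_comp; apply: eq_map_poly => a; apply: hc.
have iota_c a : iota (tofrac a%:P) = cst a by rewrite iotaE map_polyC hornerC.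
have lambda_c a : lambda (tofrac a%:P) = series_const a by rewrite lE map_polyC hornerC.
have spl : splits (map_poly lambda mu).
  apply: (simple_extension_splits ext gen) => _ /mapP[i _ ->].
  exists (map_poly (@tofrac {poly K} \o polyC) g - (tofrac f)%:P).
  rewrite !rmorphB /= !map_polyC /= iotaE lE (mapE _ _ _ iota_c) (mapE _ _ _ lambda_c); split.
    by rewrite rootE !(hornerD, hornerN, hornerC) (curve i) subrr.
  exact: infinity_poly_splits char0 f_nonconst g_nonconst weights M_gt0 N_gt0.
have [sigma [sl sinj sall]] := simple_extension_conjugates ext pchar_fraction_poly spl.
pose w i := pullback_ord (sigma i).
have wP i : place_at_infinity cst X (w i).
  exact: (pullback_place char0 f_nonconst g_nonconst mE nE coMN r_pos iotaE curve lE (sl i)).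
have Dw v : place_at_infinity cst X v -> exists i, v = w i.
  move=> Dv; exact: (place_is_pullback char0 f_nonconst g_nonconst mE nE coMN r_pos iotaE curve ext lE sl sinj Dv).
split.
  move=> v /Dw[i ->]; split; first exact: (X_ord iotaE lE (sl i)).
  by move=> j; have [] := Y_ord char0 f_nonconst g_nonconst mE nE iotaE curve lE (sl i) j.
have : finite_set (place_at_infinity cst X).
  apply: (@sub_finite_set _ _ (range w)); last exact: finite_image.
  by move=> v /Dw[i ->]; exists i.
move=> /finite_setP[s Ds]; exists s; split=> //.
have /card_set_bijP[b [bfun binj bsurj]] := Ds.
have blt i : (b (w i) < s)%N by apply: bfun; apply: wP.
pose h i := Ordinal (blt i).
(* The [d] embeddings are grouped by the place they induce, numbered through the bijection [b]; each
   of the [s] groups has [N] members. *)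
rewrite -[LHS]card_ord -sum1_card (partition_big h predT) //=.
rewrite -[in RHS](card_ord s) mulnC -sum_nat_const; apply: eq_bigr => j _.
have [v Dv bv] : exists2 v, place_at_infinity cst X v & b v = j.
  by have [v Dv bv] := bsurj j (ltn_ord j); exists v.
have [i0 vE] := Dw v Dv; subst v.
rewrite sum1_card.
rewrite -(card_fibre char0 f_nonconst g_nonconst mE nE coMN r_pos iotaE curve gen lE i0 sl sall sinj).
apply: eq_card => i; change ((h i == j) = (w i == w i0)); rewrite -val_eqE /= -bv.
apply/eqP/eqP => [bi|wi]; last by congr b.
by apply: binj => //; apply/mem_set; apply: wP.
Qed.
End CountingPlaces.

(** * Function fields *)

Lemma common_denominator (R : idomainType) (s : seq {fraction R}) :
  exists2 D : R, D != 0 & forall z, z \in s -> exists a, z * tofrac D = tofrac a.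
Proof.
elim: s => [|z s [D D0 IH]]; first by exists 1 => //; apply: oner_neq0.
have [a [b [b0 zE]]] := fraction_numden z.
exists (D * b) => [|y]; first by rewrite mulf_neq0.
rewrite inE => /orP[/eqP->|/IH[c cE]].
  exists (a * D).
  by rewrite zE !tofracM mulrACA mulVf ?tofrac_eq0 // mulr1.
by exists (c * b); rewrite !tofracM mulrA cE.
Qed.

Lemma simple_extension_degree (F L : fieldType) (iota : {rmorphism F -> L}) theta mu :
  simple_extension iota theta mu -> has_degree (range iota) (size mu).-1.
Proof.
move=> [muP gen]; set d := (size mu).-1; have mu0 := monic_neq0 muP.1.
have smu : size mu = d.+1 by rewrite prednK // size_poly_gt0.
exists (fun i => theta ^+ i) => z; have [p zE] := gen z.
have zE' : z = (map_poly iota (p %% mu)).[theta].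
  rewrite zE {1}(divp_eq p mu) rmorphD rmorphM /= hornerD hornerM.
  by rewrite (eqP (minimal_poly_root muP)) mulr0 add0r.
have szmod : (size (map_poly iota (p %% mu)) <= d)%N.
  by rewrite size_map_poly -ltnS -smu ltn_modp.
exists [ffun i : 'I_d => iota (p %% mu)`_i]; split.
  split=> [i|]; first by rewrite ffunE; exists (p %% mu)`_i.
  rewrite zE' (horner_coef_wide _ szmod).
  by apply: eq_bigr => i _; rewrite ffunE coef_map.
move=> c [crange cz].
have ex i : {a : F | iota a = c i}.
  by apply: cid; have [a _ <-] := crange i; exists a.
pose q := \poly_(j < d) (if insub j is Some i then sval (ex i) else 0).
have szq : (size q <= d)%N := size_poly _ _.
have qc (i : 'I_d) : iota q`_i = c i.
  by rewrite coef_poly ltn_ord valK; case: (ex i).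
have : mu %| q - p %% mu.
  rewrite -muP.2 rmorphB /= rootE hornerD hornerN -zE' subr_eq0; apply/eqP.
  rewrite (@horner_coef_wide _ d) ?size_map_poly // cz.
  by apply: eq_bigr => i _; rewrite coef_map /= qc.
have sz : (size (q - p %% mu)%R < size mu)%N.
  rewrite smu ltnS (leq_trans (size_polyD _ _)) // geq_max szq size_polyN.
  by rewrite -(size_map_poly iota).
have [/eqP|n0 /(dvdp_leq n0)] := eqVneq (q - p %% mu) 0; last by rewrite leqNgt sz.
rewrite subr_eq0 => /eqP qE _; apply/ffunP => i.
by rewrite ffunE -qE qc.
Qed.

Section FunctionFields.
Variables (k : fieldType) (n : nat) (Z : prime_ideal {mpoly k[n]}).
Local Notation L := (function_field Z).

Lemma restr_is_zmod_morphism : zmod_morphism (restr Z).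
Proof. by move=> p q; rewrite /restr !rmorphB. Qed.
Lemma restr_is_monoid_morphism : monoid_morphism (restr Z).
Proof.
by split=> [|p q]; rewrite /restr ?rmorph1 ?rmorphM.
Qed.
HB.instance Definition _ := GRing.isZmodMorphism.Build {mpoly k[n]} L
  (restr Z) restr_is_zmod_morphism.
HB.instance Definition _ := GRing.isMonoidMorphism.Build {mpoly k[n]} L
  (restr Z) restr_is_monoid_morphism.

Lemma restr_eq0 p : restr Z p = 0 <-> prime_set Z p.
Proof.
rewrite /restr; split.
  move=> /eqP; rewrite tofrac_eq0 -(rmorph0 (\pi_({ideal_quot (prime_pred Z)})%qT)).
  by rewrite -Quotient.idealrBE subr0 => /set_mem.
move=> Zp; apply/eqP; rewrite tofrac_eq0 -(rmorph0 (\pi_({ideal_quot (prime_pred Z)})%qT)).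
by rewrite -Quotient.idealrBE subr0; apply/mem_set.
Qed.

Lemma tofrac_restr (a : coord_ring Z) : exists p, tofrac a = restr Z p.
Proof. by exists (repr a); rewrite /restr reprK. Qed.

Lemma restr_frac (z : L) : exists p q, restr Z q != 0 /\ z = restr Z p / restr Z q.
Proof.
have [a [b [b0 ->]]] := fraction_numden z.
have [p pE] := tofrac_restr a; have [q qE] := tofrac_restr b.
by exists p, q; rewrite -pE -qE tofrac_eq0.
Qed.

Definition restr_const : k -> L := fun c => restr Z c%:MP.
HB.instance Definition _ := GRing.RMorphism.copy restr_const (restr Z \o @mpolyC n k).

Lemma restr_in_var i p : restr Z (in_var i p) = (map_poly restr_const p).[restr Z 'X_i].
Proof. by rewrite /in_var -horner_map -map_poly_comp. Qed.

Lemma generates_coordinates (S : set L) : subfield_closed S ->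
  (forall c, S (restr_const c)) -> (forall i, S (restr Z 'X_i)) -> forall z, S z.
Proof.
move=> [S1 SB SD] Sc SX.
have S0 : S 0 by rewrite -(subrr 1); apply: SB.
have SDd x y : S x -> S y -> S (x + y).
  by move=> Sx Sy; rewrite -[y]opprK -[- y]sub0r; apply: (SB) => //; apply: SB.
have SM x y : S x -> S y -> S (x * y).
  by move=> Sx Sy; rewrite -[y]invrK -[y^-1]mul1r; apply: (SD) => //; apply: SD.
have Sp p : S (restr Z p).
  rewrite [p]mpolyE rmorph_sum; apply: (big_ind S) => // m _.
  rewrite -mul_mpolyC rmorphM; apply: (SM); first exact: Sc.
  rewrite mpolyXE_id rmorph_prod; apply: (big_ind S S1 SM) => i _.
  rewrite rmorphXn; elim: (m i) => [|j IH]; first by rewrite expr0.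
  by rewrite exprS; apply: (SM) IH; apply: SX.
move=> z; have [p [q [_ ->]]] := restr_frac z; exact: SD.
Qed.
End FunctionFields.

(** * The function field of the curve as an extension of the rational functions of X *)

Section SpaceCurve.
Variables (k : fieldType) (f g : {poly k}) (r : nat) (Z : prime_ideal {mpoly k[r.+1]}).
Hypothesis g_nonconst : (1 < size g)%N.
Hypothesis Zcurve : forall i : 'I_r, prime_set Z (in_var varX f - in_var (varY i) g).
Hypothesis Z_dom : dominates_X Z.
Local Notation L := (function_field Z).
Local Notation F := {fraction {poly k}}.
Local Notation X := (restr Z 'X_varX).
Local Notation Y i := (restr Z 'X_(varY i)).

Lemma curve_equation i : (map_poly (restr_const Z) f).[X] = (map_poly (restr_const Z) g).[Y i].
Proof.
apply/eqP; rewrite -subr_eq0 -!restr_in_var -rmorphB; apply/eqP.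
exact/restr_eq0.
Qed.

(** Dominance is exactly injectivity of [k[X]] into the function field. *)
Lemma rational_functions_of_X : exists iota : {rmorphism F -> L},
  forall p, iota (tofrac p) = (map_poly (restr_const Z) p).[X].
Proof.
have inj : injective (horner_eval X \o map_poly (restr_const Z)).
  move=> p q; rewrite /= /horner_eval => pq; apply/eqP; rewrite -subr_eq0; apply/eqP.
  apply: Z_dom; apply/restr_eq0.
  by rewrite restr_in_var rmorphB hornerD hornerN pq subrr.
by have [iota iE] := fraction_lift inj; exists iota.
Qed.

Variable iota : {rmorphism F -> L}.
Hypothesis iotaE : forall p, iota (tofrac p) = (map_poly (restr_const Z) p).[X].

Lemma generates_Y : generates iota [seq Y i | i <- enum 'I_r].
Proof.
move=> S Ssub Siota SY; apply: generates_coordinates => //.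
  by move=> c; have := Siota (tofrac c%:P); rewrite iotaE map_polyC hornerC.
move=> i; case: (unliftP ord0 i) => [j ->|->].
  by apply: SY; apply/mapP; exists j; rewrite ?mem_enum.
by have := Siota (tofrac 'X); rewrite iotaE map_polyX hornerX.
Qed.

Lemma Y_algebraic i : algebraicOver iota (Y i).
Proof.
exists (map_poly (@tofrac {poly k} \o polyC) g - (tofrac f)%:P).
  apply/eqP => /(congr1 (fun p : {poly F} => size p)); rewrite size_poly0.
  rewrite size_polyDl size_map_poly; first by move=> g0; have := g_nonconst; rewrite g0.
  by rewrite size_polyN (leq_ltn_trans (size_polyC_leq1 _)).
rewrite rmorphB /= map_polyC /= iotaE rootE hornerD hornerN hornerC (curve_equation i).
rewrite -map_poly_comp subr_eq0; apply/eqP; congr (_.[_]).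
by apply: eq_map_poly => c /=; rewrite iotaE map_polyC hornerC.
Qed.

Lemma gen_subfield_range : gen_subfield X = range iota.
Proof.
apply/seteqP; split=> [z [a [b [b0 ->]]]|_ [z _ <-]].
  by exists (tofrac a / tofrac b) => //; rewrite fmorph_div !iotaE.
have [a [b [b0 ->]]] := fraction_numden z; exists a, b; split.
  by rewrite -[X in X != 0]iotaE fmorph_eq0 tofrac_eq0.
by rewrite fmorph_div !iotaE.
Qed.
End SpaceCurve.

(** * Extension of the base field *)

Section Functionals.
Variables (k K : fieldType) (iota : {rmorphism k -> K}).

Definition base_linear (psi : {additive K -> k}) : Prop :=
  forall a x, psi (iota a * x) = a * psi x.

(* The kernel of the functional is a maximal k-subspace avoiding c. *)
Lemma base_linear_exists (c : K) : c != 0 ->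
  exists2 psi : {additive K -> k}, base_linear psi & psi c = 1.
Proof.
move=> c0; pose closed (V : set K) := forall a x y, V x -> V y -> V (iota a * x + y).
have [|V [[Vcl Vc] Vmax]] := @Zorn_bigcup K (fun V => closed V /\ ~ V c).
  move=> C hC tot; split; last by move=> [V CV]; apply: (hC _ CV).2.
  move=> a x y [U CU Ux] [W CW Wy].
  have [UW|WU] := tot _ _ CU CW.
    by exists W => //; apply: (hC _ CW).1 => //; apply: UW.
  by exists U => //; apply: (hC _ CU).1 => //; apply: WU.
(* The empty set counts as [closed], because Zorn's lemma also asks for the union of the empty
   chain; maximality against [[set 0]] then excludes it. *)
have V0 : V 0.
  apply: contrapT => nV0; apply: (Vmax [set 0]).
    split=> [x Vx|Vs0]; last by apply: nV0; apply: Vs0.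
    case: nV0; have := Vcl (-1) _ _ Vx Vx.
    by rewrite rmorphN rmorph1 mulN1r addNr.
  split=> [a x y -> ->|/esym/eqP]; first by rewrite mulr0 addr0.
  by rewrite eq_sym (negPf c0).
have VZ a x : V x -> V (iota a * x).
  by move=> Vx; rewrite -[_ * _]addr0; apply: Vcl.
have VB x y : V x -> V y -> V (x - y).
  move=> Vx Vy; have := Vcl (-1) _ _ Vy Vx.
  by rewrite rmorphN rmorph1 mulN1r addrC.
have ex x : exists a, V (x - iota a * c).
  have [Vx|nVx] := pselect (V x); first by exists 0; rewrite rmorph0 mul0r subr0.
  (* For [x] outside [V], maximality forces the span [B] of [V] and [x] to contain [c]; solving that
     relation for [x] makes it a multiple of [c] modulo [V]. *)
  pose B : set K := [set y | exists b v, V v /\ y = iota b * x + v].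
  have BV v : V v -> B v by move=> Vv; exists 0, v; rewrite rmorph0 mul0r add0r.
  have Bc : B c.
    apply: contrapT => nBc; apply: (Vmax B).
      split=> // BsV; apply: nVx; apply: BsV; exists 1, 0.
      by rewrite rmorph1 mul1r addr0.
    split=> // a _ _ [b [v [Vv ->]]] [b' [v' [Vv' ->]]].
    exists (a * b + b'), (iota a * v + v'); split; first exact: Vcl.
    by rewrite rmorphD rmorphM mulrDr mulrDl mulrA addrACA.
  have [b [v [Vv cE]]] := Bc; have b0 : b != 0.
    by apply: contra_notN Vc => /eqP b0; rewrite cE b0 rmorph0 mul0r add0r.
  exists b^-1; have := VZ (- b^-1) _ Vv; rewrite cE mulrDr mulrA -rmorphM mulVf //.
  by rewrite rmorph1 mul1r opprD addNKr rmorphN mulNr.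
pose psi x := sval (cid (ex x)).
have psiP x : V (x - iota (psi x) * c) by rewrite /psi; case: cid.
have psi_eq x a : V (x - iota a * c) -> psi x = a.
  move=> Va; apply/eqP; rewrite -subr_eq0; apply: contra_notT Vc => ab0.
  have := VZ (psi x - a)^-1 _ (VB _ _ Va (psiP x)).
  rewrite opprB [X in _ * X]addrC addrA subrK -mulrBl -rmorphB mulrA -rmorphM mulVf //.
  by rewrite rmorph1 mul1r.
have psiB : zmod_morphism psi.
  move=> x y; apply: psi_eq; have := VB _ _ (psiP x) (psiP y).
  by congr V; rewrite rmorphB; ring.
pose psiH : {additive K -> k} := HB.pack psi (GRing.isZmodMorphism.Build _ _ psi psiB).
exists psiH => [a x|]; apply: psi_eq.
  by rewrite rmorphM -mulrA -mulrBr; apply: VZ.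
by rewrite rmorph1 mul1r subrr.
Qed.

Variable n : nat.

Lemma map_mpoly_mulr (psi : {additive K -> k}) (P : {mpoly K[n]}) (p : {mpoly k[n]}) :
  base_linear psi -> map_mpoly psi (P * map_mpoly iota p) = map_mpoly psi P * p.
Proof.
move=> lin; apply/mpolyP => m; rewrite mcoeff_map_mpoly !mcoeffM raddf_sum.
by apply: eq_bigr => i _; rewrite !mcoeff_map_mpoly mulrC lin mulrC.
Qed.

Lemma map_mpoly_X (psi : {additive K -> k}) c (m : 'X_{1..n}) :
  map_mpoly psi (c *: 'X_[m]) = psi c *: 'X_[m].
Proof.
apply/mpolyP => m'; rewrite mcoeff_map_mpoly !mcoeffZ !mcoeffX.
by case: eqP => _; rewrite ?mulr1 // !mulr0 raddf0.
Qed.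

Lemma map_mpoly_in_var (psi : {additive K -> k}) i (p : {poly K}) :
  map_mpoly psi (in_var i p) = in_var i (map_poly psi p) :> {mpoly k[n]}.
Proof.
(* [psi] is only additive and does not commute with evaluation, so the evaluation is expanded into
   monomials. *)
have E (R : fieldType) (q : {poly R}) d : (size q <= d)%N ->
    in_var i q = \sum_(j < d) q`_j *: 'X_[(U_(i) *+ j)%MM] :> {mpoly R[n]}.
  move=> sq; rewrite /in_var (@horner_coef_wide _ d) ?(leq_trans (size_poly _ _)) //.
  by apply: eq_bigr => j _; rewrite coef_map /= mul_mpolyC mpolyXn.
rewrite (E _ p (size p)) // (E _ _ (size p)) ?size_poly //.
by rewrite raddf_sum; apply: eq_bigr => j _; rewrite /= map_mpoly_X coef_map.
Qed.
End Functionals.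

Section BaseChangeIdeal.
Variables (k K : fieldType) (iota : {rmorphism k -> K}) (n : nat).
Variable Z : prime_ideal {mpoly k[n]}.

Lemma base_change_map p : prime_set Z p -> base_change_ideal iota Z (map_mpoly iota p).
Proof. by move=> Zp; apply: sub_gen_smallest; exists p. Qed.

(** The polynomials sent into [Z] by every functional form an ideal containing the generators.
    Quantifying over all functionals at once is essential: multiplication by a coefficient [c]
    replaces [psi] by [x -> psi (c * x)]. *)
Lemma base_change_functional Q (psi : {additive K -> k}) : base_linear iota psi ->
  base_change_ideal iota Z Q -> prime_set Z (map_mpoly psi Q).
Proof.
case: (prime_setP Z) => -[Z0 ZD ZM] _ _ lin ZQ; move: Q ZQ psi lin.
pose I : set {mpoly K[n]} := fun Q => forall psi : {additive K -> k},
  base_linear iota psi -> prime_set Z (map_mpoly psi Q).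
suff : base_change_ideal iota Z `<=` I by move=> sub Q ZQ; exact: (sub Q ZQ).
apply: smallest_sub; last first.
  move=> _ [p Zp <-] psi lin; have := map_mpoly_mulr 1 p lin.
  by rewrite mul1r => ->; apply: ZM.
split.
- by move=> psi lin; rewrite raddf0.
- by move=> a b Ia Ib psi lin; rewrite raddfD; apply: ZD; [apply: Ia|apply: Ib].
move=> a b Ib psi lin; rewrite [a]mpolyE mulr_suml raddf_sum.
apply: (big_ind (fun x => prime_set Z x)) => // m _; set c := a@_m.
have psicB : zmod_morphism (fun x => psi (c * x)).
  by move=> x y; rewrite mulrBr raddfB.
pose psic : {additive K -> k} :=
  HB.pack (fun x => psi (c * x)) (GRing.isZmodMorphism.Build K k _ psicB).
have linc : base_linear iota psic by move=> x y; rewrite /= mulrCA lin.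
suff E : map_mpoly psi (c *: 'X_[m] * b) = 'X_[m] * map_mpoly psic b.
  by rewrite /= E; apply: ZM; apply: Ib.
apply/mpolyP => m'; rewrite mcoeff_map_mpoly !mcoeffM raddf_sum.
apply: eq_bigr => i _; rewrite mcoeff_map_mpoly mcoeffZ !mcoeffX.
by case: eqP => _; rewrite ?mulr1 ?mul1r // mulr0 !mul0r raddf0.
Qed.
End BaseChangeIdeal.

Lemma map_in_var (k K : fieldType) (iota : {rmorphism k -> K}) n (i : 'I_n) (p : {poly k}) :
  map_mpoly iota (in_var i p) = in_var i (map_poly iota p).
Proof.
rewrite /in_var -horner_map /= -!map_poly_comp map_mpolyX; congr (_.[_]).
by apply: eq_map_poly => c /=; rewrite map_mpolyC.
Qed.

(** * The function field after extension of constants *)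

Section FunctionFieldBaseChange.
Variables (k K : fieldType) (iota : {rmorphism k -> K}) (r : nat).
Variable Z : prime_ideal {mpoly k[r.+1]}.
Hypothesis Z_geom : geometrically_integral iota Z.
Hypothesis Z_dom : dominates_X Z.
Let Zb := base_change Z_geom.
Local Notation L := (function_field Z).
Local Notation Lb := (function_field Zb).
Local Notation Xb := (restr Zb 'X_varX).

Lemma base_change_dominates : dominates_X Zb.
Proof.
move=> p Zp; apply/polyP => i; rewrite coef0; apply/eqP; apply: contraT => pi0.
(* A functional equal to 1 on a nonzero coefficient keeps the polynomial nonzero over [k], against
   dominance of [Z]. *)
have [psi lin psi1] := base_linear_exists iota pi0.
have : prime_set Z (map_mpoly psi (in_var varX p)) by apply: base_change_functional Zp.
rewrite map_mpoly_in_var => /Z_dom /(congr1 (fun q : {poly k} => q`_i)) /eqP.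
by rewrite coef_map coef0 psi1 oner_eq0.
Qed.

Lemma base_change_restr_eq0 p : restr Zb (map_mpoly iota p) = 0 -> restr Z p = 0.
Proof.
move=> /restr_eq0 Zp; apply/restr_eq0.
have [psi lin psi1] := base_linear_exists iota (oner_neq0 K).
have := base_change_functional lin Zp; rewrite -[map_mpoly iota p]mul1r map_mpoly_mulr //.
have -> : map_mpoly psi (1 : {mpoly K[r.+1]}) = 1.
  by rewrite -mpolyC1 map_mpolyC psi1.
by rewrite mul1r.
Qed.

Lemma function_field_base_change : exists j : {rmorphism L -> Lb},
  forall p, j (restr Z p) = restr Zb (map_mpoly iota p).
Proof.
pose h (a : coord_ring Z) : Lb := restr Zb (map_mpoly iota (repr a)).
(* The value does not depend on the representative, because the ideal of [Z] maps into its base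
   change. *)
have hE (a : coord_ring Z) p : tofrac a = restr Z p -> h a = restr Zb (map_mpoly iota p).
  move=> aE; apply/eqP; rewrite -subr_eq0 -!rmorphB; apply/eqP/restr_eq0.
  apply: base_change_map; apply/restr_eq0; rewrite rmorphB /= -aE.
  by rewrite /restr reprK subrr.
have hB : zmod_morphism h.
  move=> a b; have [p pE] := tofrac_restr a; have [q qE] := tofrac_restr b.
  rewrite (hE _ (p - q)); last by rewrite tofracB rmorphB pE qE.
  by rewrite (hE _ _ pE) (hE _ _ qE) !rmorphB.
have hM : monoid_morphism h.
  split; first by rewrite (hE _ 1) ?rmorph1.
  move=> a b; have [p pE] := tofrac_restr a; have [q qE] := tofrac_restr b.
  rewrite (hE _ (p * q)); last by rewrite tofracM rmorphM pE qE.
  by rewrite (hE _ _ pE) (hE _ _ qE) !rmorphM.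
pose hm : {rmorphism coord_ring Z -> Lb} := HB.pack h
  (GRing.isZmodMorphism.Build _ _ h hB) (GRing.isMonoidMorphism.Build _ _ h hM).
have h_inj : injective hm.
  apply: raddf_inj => a /= ha; have [p pE] := tofrac_restr a.
  apply/eqP; rewrite -tofrac_eq0 pE; apply/eqP; apply: base_change_restr_eq0.
  by rewrite -(hE _ _ pE).
have [j jE] := fraction_lift h_inj; exists j => p.
rewrite [LHS]jE; apply: hE; by [].
Qed.

Variable j : {rmorphism L -> Lb}.
Hypothesis jE : forall p, j (restr Z p) = restr Zb (map_mpoly iota p).

Lemma j_X i : j (restr Z 'X_i) = restr Zb 'X_i.
Proof. by rewrite jE map_mpolyX. Qed.

Lemma j_eval (p : {poly k}) i : j (map_poly (restr_const Z) p).[restr Z 'X_i] =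
  (map_poly (restr_const Zb) (map_poly iota p)).[restr Zb 'X_i].
Proof. by rewrite -!restr_in_var jE map_in_var. Qed.

(* Linear disjointness of K(X) and k(Z) over k(X): apply a functional K -> k
   to the coefficients. *)
Lemma functional_relation (d : nat) (u : 'I_d -> L) (q : 'I_d -> {poly K})
    (psi : {additive K -> k}) : base_linear iota psi ->
    \sum_i (map_poly (restr_const Zb) (q i)).[Xb] * j (u i) = 0 ->
  \sum_i (map_poly (restr_const Z) (map_poly psi (q i))).[restr Z 'X_varX] * u i = 0.
Proof.
move=> lin rel.
have [D D0 hD] := common_denominator [seq u i | i <- enum 'I_d].
have [Dp DE] := tofrac_restr D; have D0' : restr Z Dp != 0 by rewrite -DE tofrac_eq0.
have ex i : {p | u i * restr Z Dp = restr Z p}.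
  apply: cid; rewrite -DE; have [|a ->] := hD (u i); last exact: tofrac_restr.
  by apply/mapP; exists i; rewrite ?mem_enum.
pose num i := sval (ex i).
have numE i : u i * restr Z Dp = restr Z (num i) by rewrite /num; case: (ex i).
apply: (mulIf D0'); rewrite mul0r mulr_suml.
under eq_bigr => i _ do rewrite -mulrA numE -restr_in_var -rmorphM.
rewrite -rmorph_sum; apply/restr_eq0.
pose Q := \sum_i in_var varX (q i) * map_mpoly iota (num i).
suff -> : \sum_i in_var varX (map_poly psi (q i)) * num i = map_mpoly psi Q.
  apply: base_change_functional => //; apply/(restr_eq0 Zb).
  transitivity ((\sum_i (map_poly (restr_const Zb) (q i)).[Xb] * j (u i)) * j (restr Z Dp)).
    rewrite rmorph_sum mulr_suml.
    by apply: eq_bigr => i _; rewrite rmorphM /= restr_in_var -jE -numE rmorphM mulrA.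
  by rewrite rel mul0r.
rewrite /Q raddf_sum; apply: eq_bigr => i _.
by rewrite /= map_mpoly_mulr // map_mpoly_in_var.
Qed.

Local Notation Fk := {fraction {poly k}}.
Local Notation FK := {fraction {poly K}}.
Variables (ik : {rmorphism Fk -> L}) (iK : {rmorphism FK -> Lb}).
Hypothesis ikE : forall p, ik (tofrac p) = (map_poly (restr_const Z) p).[restr Z 'X_varX].
Hypothesis iKE : forall p, iK (tofrac p) = (map_poly (restr_const Zb) p).[Xb].

Lemma fraction_base_change : exists phi : {rmorphism Fk -> FK},
  forall c, j (ik c) = iK (phi c).
Proof.
have inj : injective (@tofrac {poly K} \o map_poly iota).
  by move=> p q /eqP; rewrite /= tofrac_eq => /eqP/map_poly_inj.
have [phi phiE] := fraction_lift inj; exists phi.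
apply: (@rmorph_fraction_eq _ _ (j \o ik) (iK \o phi)) => p.
by rewrite /= ikE phiE /= iKE j_eval.
Qed.

Variable phi : {rmorphism Fk -> FK}.
Hypothesis j_ik : forall c, j (ik c) = iK (phi c).
Variables (theta : L) (mu : {poly Fk}).
Hypothesis ext : simple_extension ik theta mu.

Lemma j_horner p : j (map_poly ik p).[theta] = (map_poly iK (map_poly phi p)).[j theta].
Proof.
rewrite -horner_map -!map_poly_comp; congr (_.[_]).
by apply: eq_map_poly => c /=; rewrite j_ik.
Qed.

(** After clearing denominators, a functional that is 1 on the leading coefficient of the top
    coefficient of [p] yields a nonzero relation for [theta] over [k(X)] of size below that of
    [mu]. *)
Lemma base_change_independent (p : {poly FK}) : (size p < size mu)%N ->
  root (map_poly iK p) (j theta) -> p = 0.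
Proof.
move=> sp pr; apply/eqP; apply: contraT => p0.
have [D D0 hD] := common_denominator p.
have DF : tofrac D != 0 by rewrite tofrac_eq0.
pose d := size p.
have ex (i : 'I_d) : {q | p`_i * tofrac D = tofrac q}.
  by apply: cid; apply: hD; apply: mem_nth.
pose q i := sval (ex i).
have qE (i : 'I_d) : p`_i * tofrac D = tofrac (q i) by rewrite /q; case: (ex i).
have dlt : (d.-1 < d)%N by rewrite /d ltn_predL size_poly_gt0.
pose top := Ordinal dlt.
have qtop : q top != 0.
  rewrite -tofrac_eq0 -qE mulf_neq0 //= -lead_coefE lead_coef_eq0 //.
have ctop : lead_coef (q top) != 0 by rewrite lead_coef_eq0.
have [psi lin psi1] := base_linear_exists iota ctop.
have rel : \sum_i (map_poly (restr_const Zb) (q i)).[Xb] * j (theta ^+ i) = 0.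
  move: pr; rewrite rootE horner_coef size_map_poly => /eqP pr.
  transitivity ((\sum_(i < size p) (map_poly iK p)`_i * j theta ^+ i) * iK (tofrac D)).
    rewrite mulr_suml; apply: eq_bigr => i _.
    by rewrite -iKE -qE coef_map /= rmorphM rmorphXn mulrAC.
  by rewrite pr mul0r.
have := functional_relation lin rel.
under eq_bigr => i _ do rewrite -ikE.
pose s : {poly Fk} := \poly_(i < d)
  (if insub i is Some i' then tofrac (map_poly psi (q i')) else 0).
have sE (i : 'I_d) : s`_i = tofrac (map_poly psi (q i)) by rewrite coef_poly ltn_ord valK.
move=> srel; have : mu %| s.
  rewrite -ext.1.2 rootE (@horner_coef_wide _ d) ?size_map_poly ?size_poly //.
  apply/eqP; apply: etrans srel; apply: eq_bigr => i _; rewrite coef_map /= sE //.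
have ssz : (size s < size mu)%N by apply: leq_ltn_trans sp; apply: size_poly.
have [s0|s0 /(dvdp_leq s0)] := eqVneq s 0; last by rewrite leqNgt ssz.
have /eqP := sE top; rewrite s0 coef0 eq_sym tofrac_eq0 => /eqP.
move=> /(congr1 (fun h : {poly k} => h`_(size (q top)).-1)) /eqP.
by rewrite coef_map coef0 -lead_coefE psi1 oner_eq0.
Qed.

(** Since [mu] stays minimal, the degrees over [k(X)] and over [K(X)] are both [(size mu).-1]. *)
Lemma simple_extension_base_change : simple_extension iK (j theta) (map_poly phi mu).
Proof.
have mub : map_poly phi mu \is monic by rewrite monic_map // ext.1.1.
have rmub : root (map_poly iK (map_poly phi mu)) (j theta).
  by rewrite rootE -j_horner (eqP (minimal_poly_root ext.1)) rmorph0.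
have minp : minimal_poly iK (j theta) (map_poly phi mu).
  split=> // p; apply/idP/idP => [pr|/dvdpP[u ->]]; last by rewrite rmorphM rootM rmub orbT.
  apply/modp_eq0P/base_change_independent.
    by rewrite -[X in (_ < X)%N](size_map_poly phi) ltn_modp monic_neq0.
  move: pr; rewrite {1}(divp_eq p (map_poly phi mu)) rmorphD rmorphM /= !rootE.
  by rewrite hornerD hornerM (eqP rmub) mulr0 add0r.
split=> //; apply: (@generates_Y _ r Zb iK iKE); first exact: minimal_poly_subfield minp.
  by move=> c; exists c%:P; rewrite map_polyC hornerC.
move=> _ /mapP[i _ ->]; have [p pE] := ext.2 (restr Z 'X_(varY i)).
by exists (map_poly phi p); rewrite -j_horner -pE j_X.
Qed.
End FunctionFieldBaseChange.

(** * The boundary *)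

Lemma comp_in_var (k : fieldType) n m (lq : n.-tuple {mpoly k[m]}) (i : 'I_n) (j : 'I_m) p :
  lq`_i = 'X_j -> in_var i p \mPo lq = in_var j p.
Proof.
move=> e; rewrite /in_var -horner_map /= -map_poly_comp comp_mpolyXU e; congr (_.[_]).
by apply: eq_map_poly => c /=; rewrite comp_mpolyC.
Qed.

(** Passing to reduced unions of selected components only enlarges ideals, so the equations
    [f(X) = g(Y_i)] survive both selections. *)
Lemma config_ideal_curve (k : fieldType) (f g : {poly k}) (r : nat) (i : 'I_r) :
  config_ideal f g r (in_var varX f - in_var (varY i) g).
Proof.
move=> q [_ sub _] _; apply: sub; apply: sub_gen_smallest.
exists i, (in_var varX f - in_var (varY ord0) g); split.
  by move=> q' [_ sub' _] _; apply: sub'; apply: sub_gen_smallest.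
by rewrite rmorphB /= (@comp_in_var _ _ _ _ _ varX) // (@comp_in_var _ _ _ _ _ (varY i)).
Qed.

Section Boundary.
Variables (k : fieldType) (f g : {poly k}) (r : nat) (Z : prime_ideal {mpoly k[r.+1]}).
Hypothesis g_nonconst : (1 < size g)%N.
Hypothesis Zcurve : forall i : 'I_r, prime_set Z (in_var varX f - in_var (varY i) g).
Local Notation L := (function_field Z).
Local Notation X := (restr Z 'X_varX).
Local Notation Y i := (restr Z 'X_(varY i)).

Section Regular.
Variable v : L -> int.
Hypotheses (vP : valuation v) (vc : forall c, c != 0 -> v (restr_const Z c) = 0).

Let vge_cst c : vge v 0 (restr_const Z c).
Proof.
have [->|c0] := eqVneq c 0; first by rewrite rmorph0 vge0.
by rewrite vgeE ?fmorph_eq0 // vc.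
Qed.

(** [Y i] is integral over [k[X]]: dividing [g(T) - f(X)] by the constant leading coefficient of [g]
    makes it monic in [T]. *)
Lemma vge_Y i : vge v 0 X -> vge v 0 (Y i).
Proof.
move=> vX; set w := (map_poly (restr_const Z) f).[X].
have vw : vge v 0 w by apply: vge_horner => // j; rewrite coef_map; apply: vge_cst.
set a := restr_const Z (lead_coef g); have lg : lead_coef g != 0.
  by rewrite lead_coef_eq0 -size_poly_gt0 ltnW.
have a0 : a != 0 by rewrite fmorph_eq0.
have va : vge v 0 a^-1 by rewrite vgeE ?invr_eq0 // val_inv // vc // oppr0.
pose p := a^-1 *: (map_poly (restr_const Z) g - w%:P).
apply: (@vge_integral _ v vP p).
- rewrite monicE lead_coefZ lead_coefDl ?lead_coef_map ?mulVf //.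
  by rewrite size_polyN size_map_poly (leq_ltn_trans (size_polyC_leq1 _)).
- move=> j; rewrite coefZ coefB coef_map coefC; apply: vgeM0 => //; apply: vgeB => //.
    exact: vge_cst.
  by case: ifP => // _; apply: vge0.
rewrite rootE hornerZ hornerD hornerN hornerC.
by rewrite -(curve_equation Zcurve i) subrr mulr0.
Qed.

Lemma vge_normalization z : vge v 0 X -> normalization z -> vge v 0 z.
Proof.
move=> vX [p mp pz]; apply: (vge_integral vP (monic_map _ mp) _ pz) => i.
rewrite coef_map /=; have [q ->] := tofrac_restr p`_i.
rewrite [q]mpolyE rmorph_sum; apply: vge_sum => // m _.
rewrite -mul_mpolyC rmorphM; apply: vgeM0 => //; first exact: vge_cst.
rewrite mpolyXE_id rmorph_prod; apply: (big_ind (fun x => vge v 0 x)).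
- exact: vge1.
- by move=> x y; apply: vgeM0.
move=> j _; rewrite rmorphXn; apply: vgeX => //=.
by case: (unliftP ord0 j) => [l ->|->//]; apply: vge_Y.
Qed.
End Regular.

(** The affine normalization is integral over [k[X]], and contains [X]; hence a place lies on it
    exactly when [X] has no pole there. *)
Lemma boundary_at_infinity : boundary Z = place_at_infinity (restr_const Z : {rmorphism k -> L}) X.
Proof.
apply/seteqP; split=> v.
  move=> [[[v0 nv] vc vM vD] nreg]; have vP : valuation v by [].
  split=> //; rewrite ltNge; apply/negP => vX; apply: nreg => z nz.
  have hX : vge v 0 X by rewrite /vge vX orbT.
  by have /orP[/eqP->|//] := vge_normalization vP vc hX nz; rewrite v0.
move=> [v0 nv vc vP vX]; split; first by split=> //; [exact: vP.1|exact: vP.2].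
move=> reg; have := reg X; rewrite leNgt vX => /(_ _)/negP; apply=> //.
exact: integral_id.
Qed.
End Boundary.

Theorem theorem6p7 (k : fieldType) (K : closedFieldType)
  (iota : {rmorphism k -> K}) (f g : {poly k}) (r : nat)
  (Z : prime_ideal {mpoly k[r.+1]})
  (char_k : [pchar k] =i pred0)
  (K_closure : is_algebraic_closure iota)
  (f_nonconst : (1 < size f)%N) (g_nonconst : (1 < size g)%N)
  (r_pos : (1 <= r)%N)
  (Z_component : is_component (config_ideal f g r) Z)
  (Z_geom : geometrically_integral iota Z)
  (Z_dom : dominates_X Z) :
  let m := (size f).-1 in
  let n := (size g).-1 in
  let e := gcdn m n in
  let M := (m %/ e)%N in
  let N := (n %/ e)%N in
  let Zbar := base_change Z_geom in
  let X := restr Zbar 'X_varX in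
  let Y (i : 'I_r) := restr Zbar 'X_(varY i) in
  let D := boundary Zbar in
  [/\ forall ordP, D ordP ->
        - ordP X = N%:Z /\ forall i : 'I_r, - ordP (Y i) = M%:Z,
      exists s : nat, (D #= `I_s)%card /\ X_degree Z (N * s)
    & (D #= `I_1)%card -> X_degree Z N].
Proof.
move=> m n e M N Zbar X Y D.
have Zcurve i : prime_set Z (in_var varX f - in_var (varY i) g).
  by case: Z_component => _ sub _; apply: sub; apply: config_ideal_curve.
have Zbcurve i : prime_set Zbar
    (in_var varX (map_poly iota f) - in_var (varY i) (map_poly iota g)).
  by rewrite -!map_in_var -rmorphB; apply: base_change_map.
have Zbdom : dominates_X Zbar by apply: base_change_dominates.
have gb_nonconst : (1 < size (map_poly iota g))%N by rewrite size_map_poly.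
have fb_nonconst : (1 < size (map_poly iota f))%N by rewrite size_map_poly.
have [ik ikE] := rational_functions_of_X Z_dom.
have [iK iKE] := rational_functions_of_X Zbdom.
have charF : [pchar {fraction {poly k}}] =i pred0.
  by move=> p; rewrite (fmorph_pchar (@tofrac {poly k} \o polyC)) char_k.
have charK : [pchar K] =i pred0 by move=> p; rewrite (fmorph_pchar iota) char_k.
have [theta [mu ext]] : exists theta mu, simple_extension ik theta mu.
  apply: simple_extension_exists charF _ (generates_Y ikE).
  by move=> _ /mapP[i _ ->]; apply: (Y_algebraic g_nonconst Zcurve ikE).
have [j jE] := function_field_base_change Z_geom.
have [phi j_ik] := fraction_base_change jE ikE iKE.
have extb := simple_extension_base_change jE ikE iKE j_ik ext.
have e_gt0 : (0 < e)%N by rewrite gcdn_gt0 /m -subn1 subn_gt0 f_nonconst.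
have mE : (size (map_poly iota f)).-1 = (M * e)%N.
  by rewrite size_map_poly divnK // dvdn_gcdl.
have nE : (size (map_poly iota g)).-1 = (N * e)%N.
  by rewrite size_map_poly divnK // dvdn_gcdr.
have coMN : coprime M N.
  rewrite /coprime -(eqn_pmul2r e_gt0) muln_gcdl mul1n.
  by rewrite !divnK ?dvdn_gcdl ?dvdn_gcdr.
have [orders [s [Ds ds]]] := places_at_infinity charK fb_nonconst gb_nonconst mE nE coMN
  r_pos iKE (curve_equation Zbcurve) (generates_Y iKE) extb.
have DE : D = place_at_infinity (restr_const Zbar : {rmorphism K -> function_field Zbar}) X.
  exact: boundary_at_infinity gb_nonconst Zbcurve.
(* The place count concerns [map_poly phi mu] over [K(X)], the degree concerns [mu] over [k(X)]; the
   two have the same size. *)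
have deg : X_degree Z (N * s).
  rewrite /X_degree (gen_subfield_range ikE) -ds size_map_poly.
  exact: (simple_extension_degree ext).
rewrite DE; split.
- by move=> v /orders[-> h]; split=> [|i]; rewrite ?h opprK.
- by exists s.
rewrite (card_eql Ds) => /card_eq_II s1; move: deg.
by rewrite s1 muln1.
Qed.
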